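(* Let $M$ be a loopless matroid of rank $d+1$ on $E=\{0,\dots,n\}$. For each $0\le c\le d$, the cap product map $A^c_\nabla(M)\to\operatorname{MW}_{d-c}(\Sigma_M)$, $\xi\mapsto\xi\cap\Delta_M$, induces a bijection between the nested basis of $A^c_\nabla(M)$, namely the monomials \[h_{F_1}^{a_1}\cdots h_{F_k}^{a_k},\quad \textstyle\sum_i a_i=c,\ \emptyset=F_0\subsetneq F_1\subsetneq\cdots\subsetneq F_k\text{ flats of }M,\ 1\le a_i<\operatorname{rk}_M(F_i)-\operatorname{rk}_M(F_{i-1}),\] and the set of Bergman classes $\Delta_{M'}$ of loopless relative nested quotients $M'\twoheadleftarrow M$ with $\operatorname{rk}(M')=\operatorname{rk}(M)-c$.
   Context: Let $N=\mathbb Z^E/\mathbb Z\mathbf e_E$ and $u_S$ the image of $\sum_{i\in S}\mathbf e_i$. The Bergman fan $\Sigma_M$ is the fan whose cones are $\operatorname{Cone}(u_{F_1},\dots,u_{F_k})$ for chains $\emptyset\subsetneq F_1\subsetneq\cdots\subsetneq F_k\subsetneq E$ of flats of $M$ (a subfan of the braid fan, whose cones come from chains of arbitrary subsets). For a smooth fan $\Sigma$, $A^\bullet(\Sigma)=\mathbb R[x_\rho]/(\text{monomials of non-faces}+\langle\sum_\rho m(u_\rho)x_\rho:m\in N^\vee\rangle)$; $\operatorname{MW}_\ell(\Sigma)$ is the space of Minkowski weights (functions on $\ell$-cones satisfying the balancing condition $\sum_{\sigma\succ\tau}\Delta(\sigma)u_{\sigma\setminus\tau}\in\operatorname{span}\tau$);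 the cap product is $(\xi\cap\Delta)(\sigma)=$ value of the functional $\prod_{\rho\in\tau}x_\rho\mapsto\Delta(\tau)$ on $\xi\prod_{\rho\in\sigma}x_\rho$. The Chow ring $A^\bullet(M)=A^\bullet(\Sigma_M)$ has variables $x_F$ for nonempty proper flats; the simplicial presentation $A^\bullet_\nabla(M)$ has generators $h_F$ ($F$ nonempty flat) with $h_F=\alpha-\sum_{F\subseteq G\subsetneq E}x_G$, where $\alpha=\sum_{G\ni i}x_G$ for any $i\in E$ (sums over proper flats). For a loopless matroid $M'$ of rank $r'$ on $E$, the Bergman class $\Delta_{M'}$ is the $(r'-1)$-dimensional weight equal to $1$ on cones of chains of $r'-1$ proper nonempty flats of $M'$ and $0$ elsewhere. $M'$ is a quotient of $M$ ($f:M'\twoheadleftarrow M$) if every flat of $M'$ is a flat of $M$; $n_f(A)=\operatorname{rk}_M(A)-\operatorname{rk}_{M'}(A)$; an $f$-cyclic flat is a flat $F$ of $M'$ minimal under inclusion among flats of $M'$ with the same $f$-nullity; $M'$ is a relative nested quotient of $M$ if its $f$-cyclic flats form a chain. *)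

(* Defs.v *)
From HB Require Import structures.
From mathcomp Require Import all_boot all_order all_algebra.
From mathcomp Require Import mpoly.
Set Implicit Arguments. Unset Strict Implicit. Unset Printing Implicit Defensive.
Import Order.TTheory GRing.Theory Num.Theory.
Local Open Scope ring_scope.

Record matroid (T : finType) := Matroid {
  rk : {set T} -> nat;
  rk_card : forall A, (rk A <= #|A|)%N;
  rk_mono : forall A B : {set T}, A \subset B -> (rk A <= rk B)%N;
  rk_submod : forall A B : {set T}, (rk (A :|: B) + rk (A :&: B) <= rk A + rk B)%N }.

Section MatroidDefs.
Variable T : finType.
Implicit Types (M N : matroid T) (F G A : {set T}) (S : {set {set T}}).

Definition flat M F : bool :=
  [forall x, (x \notin F) ==> (rk M F < rk M (x |: F))%N].

Definition loopless M : Prop := forall x : T, rk M [set x] = 1%N.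

(* nonempty proper flat = ray of the Bergman fan *)
Definition npflat M F : bool := [&& flat M F, F != set0 & F != setT].

Definition is_chain S : bool :=
  [forall F in S, forall G in S, (F \subset G) || (G \subset F)].

(* cone of Sigma_M of dimension k: a chain of k nonempty proper flats *)
Definition cone M (k : nat) S : bool :=
  [&& is_chain S, [forall F in S, npflat M F] & #|S| == k].

Definition quotient (M' M : matroid T) : Prop :=
  forall F, flat M' F -> flat M F.

Definition nullity (M' M : matroid T) A : int := (rk M A)%:Z - (rk M' A)%:Z.

Definition fcyclic (M' M : matroid T) F : Prop :=
  flat M' F /\
  forall G, flat M' G -> G \proper F -> nullity M' M G <> nullity M' M F.

Definition rel_nested (M' M : matroid T) : Prop :=
  forall F G, fcyclic M' M F -> fcyclic M' M G ->
    F \subset G \/ G \subset F.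

Definition bergman (R : ringType) (M' : matroid T) S : R :=
  if [&& is_chain S, [forall F in S, npflat M' F] &
         #|S| == (rk M' setT).-1] then 1 else 0.
End MatroidDefs.

(* variables x_S indexed by all subsets S of E = 'I_n.+1; the variables
   for S not a nonempty proper flat are killed in the ideal *)
Definition nvar (n : nat) := #|{set 'I_n.+1}|.
Notation cpoly R n := {mpoly R[nvar n]}.

Section Chow.
Variables (R : comRingType) (n : nat).
Local Notation E := ('I_n.+1).
Implicit Types (M : matroid E) (F G : {set E}) (S : {set {set E}}).

Definition xv F : cpoly R n := 'X_(enum_rank F).
Definition xmono S : cpoly R n := \prod_(F in S) xv F.

Definition chow_gen M (p : cpoly R n) : Prop :=
  (exists F, ~~ npflat M F /\ p = xv F) \/
  (exists S, [forall F in S, npflat M F] /\ ~~ is_chain S /\ p = xmono S) \/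
  (exists m : E -> int, \sum_(i : E) m i = 0 /\
     p = \sum_(F | npflat M F) (\sum_(i in F) m i)%:~R *: xv F).

Definition in_ideal (P : cpoly R n -> Prop) (p : cpoly R n) : Prop :=
  exists s : seq (cpoly R n * cpoly R n),
    (forall q, q \in s -> P q.2) /\ p = \sum_(q <- s) q.1 * q.2.

Definition alpha M : cpoly R n := \sum_(G | npflat M G && (ord0 \in G)) xv G.
Definition hv M F : cpoly R n :=
  alpha M - \sum_(G | npflat M G && (F \subset G)) xv G.

(* nested monomials: s = [:: (F_1,a_1); ...; (F_k,a_k)] *)
Definition nested_rel M (p q : {set E} * nat) : bool :=
  [&& p.1 \proper q.1, (0 < q.2)%N & (q.2 < rk M q.1 - rk M p.1)%N].

Definition nested M (c : nat) (s : seq ({set E} * nat)) : Prop :=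
  [/\ all (fun p => flat M p.1) s, path (nested_rel M) (set0, 0%N) s &
      sumn (map snd s) = c].

Definition nb_monomial M (s : seq ({set E} * nat)) : cpoly R n :=
  \prod_(p <- s) hv M p.1 ^+ p.2.

(* the degree functional on A^d(M) induced by Delta_M, lifted to polynomials *)
Definition degfun M (d : nat) (phi : cpoly R n -> R) : Prop :=
  [/\ forall a p q, phi (a *: p + q) = a * phi p + phi q,
      forall p, in_ideal (chow_gen M) p -> phi p = 0 &
      forall tau, cone M d tau -> phi (xmono tau) = bergman R M tau].

(* cap product: (xi cap Delta_M)(sigma) = phi(xi * x_sigma) *)
Definition capw (phi : cpoly R n -> R) (xi : cpoly R n) (S : {set {set E}}) : R :=
  phi (xi * xmono S).
End Chow.

(* Main.v *)
Require Import Defs.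
From HB Require Import structures.
From mathcomp Require Import all_boot all_order all_algebra.
From mathcomp Require Import mpoly zify ring.
Import Order.TTheory GRing.Theory Num.Theory.
Set Implicit Arguments. Unset Strict Implicit. Unset Printing Implicit Defensive.
Local Open Scope ring_scope.

(* Multiplication by h_F intersects Delta_M with the principal truncation of M
   along F: for i in F one has h_F = sum of the x_G over flats G that contain i
   but not F, so h_F annihilates x_G as soon as G is no longer a flat of the
   truncation, and p |-> phi (p * h_F) is the degree functional of the truncated
   matroid.  A nested monomial thus caps Delta_M to the Bergman class of an
   iterated truncation M' along a chain of flats F_1 < ... < F_k; its nullity at
   a flat G is the sum of the a_i with F_i <= G, so the f-cyclic flats of M' are
   exactly set0, F_1, ..., F_k.  Conversely the rank of a relative nested
   quotient is the minimum of rk (A U C) - nullity C over its f-cyclic flats C,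
   which is the rank function of such an iterated truncation.

   The degree functional exists because in the variables h_F it can be defined
   monomial by monomial: it is 1 when truncating along all the factors leaves a
   loopless matroid, and 0 otherwise.  The relation x_F x_G = 0 for incomparable
   F, G comes down to (h_F - h_K)(h_G - h_K) = 0 with K the join of F and G, an
   identity on loopless matroids of rank 3. *)

(** * Matroids *)

Section MatroidTheory.
Variable T : finType.
Implicit Types (M N : matroid T) (A B C F G : {set T}) (S : {set {set T}}).
Local Open Scope nat_scope.

Lemma rk0 M : rk M set0 = 0.
Proof. by apply/eqP; rewrite -leqn0 -[X in _ <= X](cards0 T) rk_card. Qed.

Lemma rkU1 M x A : rk M (x |: A) <= (rk M A).+1.
Proof.
have := rk_submod M [set x] A; have := rk_card M [set x].
by rewrite cards1; lia.
Qed.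

(** Submodularity for [B] and [A :|: C], whose union is [B :|: C] and whose intersection contains
    [A]. *)
Lemma rk_dimret M A B C : A \subset B ->
  rk M (B :|: C) + rk M A <= rk M B + rk M (A :|: C).
Proof.
move=> sAB; have := rk_submod M B (A :|: C).
rewrite setUA (setUidPl sAB); apply: leq_trans.
by rewrite leq_add2l rk_mono // subsetI sAB subsetUl.
Qed.

Lemma rkU_same M A B : (forall x, x \in B -> rk M (x |: A) = rk M A) ->
  rk M (A :|: B) = rk M A.
Proof.
elim: {B}#|B| {-2}B (leqnn #|B|) => [|k IH] B.
  by rewrite leqn0 cards_eq0 => /eqP->; rewrite setU0.
have [-> _ _|[x xB]] := set_0Vmem B; first by rewrite setU0.
rewrite (cardsD1 x) xB add1n ltnS => /IH IHx clB.
have {}IHx : rk M (A :|: (B :\ x)) = rk M A.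
  by apply: IHx => y /setD1P[_ yB]; apply: clB.
have := rk_dimret M [set x] (subsetUl A (B :\ x)).
rewrite -setUA [_ :\ x :|: _]setUC setD1K // IHx (setUC A [set x]) (clB _ xB).
have := rk_mono M (subsetUl A B); lia.
Qed.

Definition cl M A : {set T} := [set x | rk M (x |: A) == rk M A].

Lemma sub_cl M A : A \subset cl M A.
Proof.
by apply/subsetP => x xA; rewrite inE (setUidPr _) ?sub1set.
Qed.

Lemma rk_cl M A : rk M (cl M A) = rk M A.
Proof.
rewrite -(setUidPr (sub_cl M A)) rkU_same // => x.
by rewrite inE => /eqP.
Qed.

Lemma rk_clU M A B : rk M (cl M A :|: B) = rk M (A :|: B).
Proof.
apply/eqP; rewrite eqn_leq andbC rk_mono ?setSU ?sub_cl //=.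
have := rk_dimret M B (sub_cl M A); rewrite rk_cl; lia.
Qed.

Lemma flatP M F :
  reflect (forall x, x \notin F -> rk M F < rk M (x |: F)) (flat M F).
Proof.
apply: (iffP forallP) => H x; first by move/implyP: (H x).
by apply/implyP/H.
Qed.

Lemma flat_cl M A : flat M (cl M A).
Proof.
apply/flatP => x; rewrite inE => xA; rewrite rk_cl setUC rk_clU setUC ltn_neqAle.
by rewrite eq_sym xA rk_mono // subsetUr.
Qed.

Lemma cl_min M A F : flat M F -> A \subset F -> cl M A \subset F.
Proof.
move=> /flatP fF sAF; apply/subsetP => x; rewrite inE => /eqP xA.
apply/negP => /negP /fF; have := rk_dimret M [set x] sAF.
by rewrite setUC (setUC A) xA; lia.
Qed.

Lemma flatT M : flat M setT.
Proof. by apply/flatP => x; rewrite inE. Qed.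

Lemma flat_proper_rk M F G : flat M F -> F \proper G -> rk M F < rk M G.
Proof.
move=> /flatP fF /properP[sFG [x xG xF]]; apply: leq_trans (fF x xF) _.
by apply: rk_mono; rewrite subUset sub1set xG.
Qed.

Lemma flat_eq_rk M F G : flat M F -> F \subset G -> rk M G <= rk M F -> F = G.
Proof.
move=> fF sFG rGF; apply/eqP; rewrite eqEproper sFG /=.
by apply/negP => /(flat_proper_rk fF); lia.
Qed.

Lemma rk_gt0 M A : loopless M -> (0 < rk M A) = (A != set0).
Proof.
move=> lM; have [->|[x xA]] := set_0Vmem A; first by rewrite rk0 eqxx.
have -> : A != set0 by apply/set0Pn; exists x.
by rewrite -(lM x) rk_mono // sub1set.
Qed.

Lemma flat0 M : loopless M -> flat M set0.
Proof. by move=> lM; apply/flatP => x _; rewrite rk0 setU0 lM. Qed.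

Lemma looplessP M : (forall x, 0 < rk M [set x]) -> loopless M.
Proof. by move=> H x; have := H x; have := rk_card M [set x]; rewrite cards1; lia. Qed.

Lemma quotient_trans M1 M2 M3 : quotient M1 M2 -> quotient M2 M3 -> quotient M1 M3.
Proof. by move=> q1 q2 F /q1/q2. Qed.

Lemma quotient_npflat M' M F : quotient M' M -> npflat M' F -> npflat M F.
Proof. by move=> q /and3P[/q fF F0 FT]; apply/and3P. Qed.

Lemma quotient_cl M' M A : quotient M' M -> cl M A \subset cl M' A.
Proof. by move=> q; rewrite cl_min ?sub_cl // q // flat_cl. Qed.

(** The nullity grows with the set: one element raises either rank by at most one, and an element
    that leaves [rk M] unchanged lies in [cl M], hence in [cl M'], so it leaves [rk M'] unchanged
    too. *)
Lemma quotient_rk M' M A B : quotient M' M -> A \subset B ->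
  rk M A + rk M' B <= rk M B + rk M' A.
Proof.
move=> q; elim: {B}#|B| {-2}B (leqnn #|B|) => [|k IH] B.
  by rewrite leqn0 cards_eq0 => /eqP->; rewrite subset0 => /eqP->.
move=> cB sAB; have [->//|neAB] := eqVneq A B.
have /properP[_ [x xB xA]] : A \proper B by rewrite properEneq neAB.
have := IH (B :\ x); rewrite subsetD1 sAB xA.
have -> : #|B :\ x| <= k by move: cB; rewrite (cardsD1 x B) xB.
move=> /(_ isT isT); have := rkU1 M' x (B :\ x).
have := rk_mono M (subD1set B x); have := quotient_cl (B :\ x) q.
move/subsetP/(_ x); rewrite !inE setD1K //; lia.
Qed.

(** Equal flats make each matroid a quotient of the other, so the nullity is nonnegative in both
    directions. *)
Lemma rk_eq_flats M1 M2 : flat M1 =1 flat M2 -> rk M1 =1 rk M2.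
Proof.
move=> eqf A; have q12 : quotient M1 M2 by move=> F; rewrite eqf.
have q21 : quotient M2 M1 by move=> F; rewrite eqf.
have := quotient_rk q12 (sub0set A); have := quotient_rk q21 (sub0set A).
by rewrite !rk0; lia.
Qed.

Lemma eq_rk_flat M1 M2 : rk M1 =1 rk M2 -> flat M1 =1 flat M2.
Proof. by move=> eqr F; apply: eq_forallb => x; rewrite !eqr. Qed.

(** * Chains of flats and maximal flags *)

Lemma is_chainP S : reflect {in S &, forall F G, (F \subset G) || (G \subset F)}
  (is_chain S).
Proof.
apply: (iffP forall_inP) => [H F G FS GS|H F FS].
  by move/forall_inP: (H F FS) => /(_ G GS).
by apply/forall_inP => G GS; apply: H.
Qed.

Lemma is_chain_sub S S' : S' \subset S -> is_chain S -> is_chain S'.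
Proof.
move=> /subsetP sS /is_chainP cS; apply/is_chainP => F G FS GS.
by apply: cS; apply: sS.
Qed.

Lemma chain_cover S : is_chain S -> S != set0 -> cover S \in S.
Proof.
move=> /is_chainP cS /set0Pn[F0 F0S].
case: (arg_maxnP (fun F => #|F|) F0S) => F FS maxF.
suff -> : cover S = F by [].
apply/eqP; rewrite eqEsubset bigcup_sup // andbT; apply/bigcupsP => G GS.
have [//|FG] := orP (cS G F GS FS).
by rewrite (_ : F = G) //; apply/eqP; rewrite eqEcard FG; apply: maxF.
Qed.

Lemma chain_cover_flat M S : loopless M -> is_chain S ->
  [forall F in S, npflat M F] -> flat M (cover S).
Proof.
move=> lM cS /forall_inP fS; have [->|S0] := eqVneq S set0.
  by rewrite /cover big_set0 flat0.
by have /and3P[] := fS _ (chain_cover cS S0).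
Qed.

(** Splitting off the largest member is the induction step for chains of flats. *)
Lemma chain_top M S : loopless M -> is_chain S -> [forall F in S, npflat M F] ->
  S != set0 -> let F := cover S in
  [/\ F \in S, is_chain (S :\ F), [forall G in S :\ F, npflat M G]
    & cover (S :\ F) \proper F].
Proof.
move=> lM cS fS S0 F; have FS : F \in S := chain_cover cS S0.
have cS' := is_chain_sub (subD1set S F) cS.
have fS' : [forall G in S :\ F, npflat M G].
  by apply/forall_inP => G /setD1P[_ GS]; move/forall_inP: fS; apply.
split=> //; rewrite properEneq; apply/andP; split; last first.
  by apply/bigcupsP => G /setD1P[_ GS]; apply: bigcup_sup.
apply/eqP => eF; have [S'0|/(chain_cover cS')] := eqVneq (S :\ F) set0.
  move: eF; rewrite S'0 /cover big_set0 => eF; move/forall_inP: fS.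
  by move/(_ _ FS)/and3P => [_]; rewrite -eF eqxx.
by rewrite eF !inE eqxx.
Qed.

Lemma chain_card_rk M S : loopless M -> is_chain S ->
  [forall F in S, npflat M F] -> #|S| <= rk M (cover S).
Proof.
move=> lM; elim: {S}#|S| {-2}S (leqnn #|S|) => [|k IH] S.
  by rewrite leqn0 => /eqP->.
move=> cardS cS fS; have [->|S0] := eqVneq S set0; first by rewrite cards0.
have [FS cS' fS' ltF] := chain_top lM cS fS S0.
have fl := chain_cover_flat lM cS' fS'.
have := flat_proper_rk fl ltF; have := IH _ _ cS' fS'.
move: cardS; rewrite (cardsD1 (cover S) S) FS add1n ltnS => c1 /(_ c1).
exact: leq_ltn_trans.
Qed.

(** Closing [F] with one more element of [G] raises the rank by exactly one. The saturated chain
    omits [F] and includes [G], so that two such chains can be glued. *)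
Lemma flag_between M F G : flat M F -> flat M G -> F \subset G ->
  exists S, [/\ is_chain S, [forall H in S, [&& flat M H, F \proper H & H \subset G]],
    #|S| = rk M G - rk M F & F != G -> G \in S].
Proof.
move=> fF fG; move e : (rk M G - rk M F) => k.
elim: k F e fF => [|k IH] F e fF sFG.
  exists set0; split; rewrite ?cards0 //.
  - by apply/is_chainP => A B; rewrite inE.
  - by apply/forall_inP => A; rewrite inE.
  by rewrite (flat_eq_rk fF sFG) ?eqxx //; lia.
have /properP[_ [x xG xF]] : F \proper G.
  by rewrite properEneq sFG andbT; apply/eqP => eFG; rewrite eFG subnn in e.
set F1 := cl M (x |: F).
have fF1 : flat M F1 by apply: flat_cl.
have rF1 : rk M F1 = (rk M F).+1.
  rewrite rk_cl; apply/eqP; rewrite eqn_leq rkU1; exact: (flatP _ _ fF).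
have sF1G : F1 \subset G by rewrite cl_min // subUset sub1set xG.
have pFF1 : F \proper F1.
  apply/properP; split; last by exists x; rewrite ?(subsetP (sub_cl _ _)) ?setU11.
  by apply: subset_trans (sub_cl _ _); apply: subsetUr.
have [|S [cS /forall_inP fS cardS GS]] := IH F1 _ fF1 sF1G; first by rewrite rF1; lia.
have F1S : F1 \notin S by apply/negP => /fS; rewrite properxx andbF.
exists (F1 |: S); split=> [||| _].
- apply/is_chainP => A B /setU1P[->|AS] /setU1P[->|BS]; rewrite ?subxx //.
  + by have /and3P[_ /proper_sub -> _] := fS _ BS.
  + by have /and3P[_ /proper_sub -> _] := fS _ AS; rewrite orbT.
  by move/is_chainP: cS; apply.
- apply/forall_inP => A /setU1P[->|/fS/and3P[fA pA sA]]; first by apply/and3P.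
  by rewrite fA sA (proper_trans pFF1).
- by rewrite cardsU1 F1S cardS.
by have [->|/GS GS1] := eqVneq F1 G; rewrite !inE ?eqxx ?GS1 ?orbT.
Qed.

(** Saturated chains from [set0] to [F] and from [F] to [setT] are glued, and [setT] is dropped,
    which accounts for the [.-1]. *)
Lemma flag_through M F : loopless M -> npflat M F ->
  exists S, cone M (rk M setT).-1 S /\ F \in S.
Proof.
move=> lM /and3P[fF F0 FT].
have [S1 [c1 /forall_inP f1 card1 FS1]] := flag_between (flat0 lM) fF (sub0set F).
have [S2 [c2 /forall_inP f2 card2 TS2]] := flag_between fF (flatT M) (subsetT F).
exists (S1 :|: (S2 :\ setT)); split; last by rewrite inE FS1 // eq_sym.
apply/and3P; split.
- apply/is_chainP => A B; rewrite !inE => /orP[A1|/andP[_ A2]] /orP[B1|/andP[_ B2]].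
  + by move/is_chainP: c1; apply.
  + have /and3P[_ _ sA] := f1 _ A1; have /and3P[_ /proper_sub sB _] := f2 _ B2.
    by rewrite (subset_trans sA sB).
  + have /and3P[_ _ sA] := f1 _ B1; have /and3P[_ /proper_sub sB _] := f2 _ A2.
    by rewrite (subset_trans sA sB) orbT.
  by move/is_chainP: c2; apply.
- apply/forall_inP => A; rewrite !inE => /orP[/f1|/andP[AT /f2]] /and3P[fA pA sA].
    apply/and3P; split=> //; first by rewrite -proper0.
    by apply: contraNneq FT => eA; rewrite -subTset -eA.
  apply/and3P; split=> //; rewrite -proper0; apply: sub_proper_trans pA.
  exact: sub0set.
rewrite cardsU (_ : _ :&: _ = set0) ?cards0 ?subn0; last first.
  apply/setP => A; rewrite !inE; apply/negP => /and3P[/f1/and3P[_ _ sA] _ /f2].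
  by move/and3P=> [_ /proper_subn]; rewrite sA.
have := cardsD1 setT S2; rewrite TS2 // card1 card2 rk0 => /=.
have := rk_mono M (subsetT F); have := rk_gt0 F lM; rewrite F0.
have := flat_proper_rk fF (_ : F \proper setT); rewrite properT FT => /(_ isT).
move: (#|_ :\ _|) => k; move=> ? ? ? ?; apply/eqP.
lia.
Qed.

Lemma flag_exists M : loopless M -> exists S, cone M (rk M setT).-1 S.
Proof.
move=> lM; have [|nF] := boolP [exists F, npflat M F].
  by case/existsP=> F /(flag_through lM)[S [cS _]]; exists S.
(* Without nonempty proper flats the closure of a point is everything, so the rank is at most one
   and the empty chain is maximal. *)
exists set0; apply/and3P; split; first by apply/is_chainP => A B; rewrite inE.
  by apply/forall_inP => A; rewrite inE.
rewrite cards0; have [x _|T0] := pickP T; last first.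
  have -> : [set: T] = set0 by apply/setP => x; have := T0 x.
  by rewrite rk0.
have := rkU_same (M := M) (A := [set x]) (B := setT).
rewrite setUT lM => -> // y _.
have := rk_cl M [set x]; move/existsPn/(_ (cl M [set x])): nF.
rewrite /npflat flat_cl /= negb_and !negbK => /orP[/eqP e|/eqP e].
  by have := sub_cl M [set x]; rewrite e sub1set inE.
by move: (in_setT y); rewrite -e inE lM => /eqP->.
Qed.

End MatroidTheory.

(** * Functionals on the Chow ring *)

Section ChowFunctionals.
Variables (R : comNzRingType) (n : nat).
Local Notation E := ('I_n.+1).
Local Notation P := (cpoly R n).
Implicit Types (M N : matroid E) (F G : {set E}) (S : {set {set E}}) (p q : P).
Implicit Types (phi : P -> R).

Definition lin phi := forall a p q, phi (a *: p + q) = a * phi p + phi q.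

Section Lin.
Variable phi : P -> R.
Hypothesis lphi : lin phi.

Lemma linD p q : phi (p + q) = phi p + phi q.
Proof. by rewrite -[p]scale1r lphi mul1r scale1r. Qed.

Lemma lin0 : phi 0 = 0.
Proof. by apply: (addrI (phi 0)); rewrite -linD !addr0. Qed.

Lemma linZ a p : phi (a *: p) = a * phi p.
Proof. by rewrite -[a *: p]addr0 lphi lin0 addr0. Qed.

Lemma linN p : phi (- p) = - phi p.
Proof. by rewrite -scaleN1r linZ mulN1r. Qed.

Lemma linB p q : phi (p - q) = phi p - phi q.
Proof. by rewrite linD linN. Qed.

Lemma lin_sum (I : Type) (r : seq I) (Q : pred I) (f : I -> P) :
  phi (\sum_(i <- r | Q i) f i) = \sum_(i <- r | Q i) phi (f i).
Proof. exact: (big_morph phi linD lin0). Qed.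

Lemma lin_mulr q : lin (fun p => phi (p * q)).
Proof. by move=> a p p'; rewrite mulrDl -scalerAl lphi. Qed.

(** The ideal of all [q] whose multiples lie in the kernel of [phi]. Congruences modulo this ideal
    replace equalities in the Chow ring. *)
Definition kills q := forall p, phi (p * q) = 0.

Lemma kills0 : kills 0.
Proof. by move=> p; rewrite mulr0 lin0. Qed.

Lemma killsMl q q' : kills q -> kills (q' * q).
Proof. by move=> kq p; rewrite mulrA kq. Qed.

Lemma killsMr q q' : kills q -> kills (q * q').
Proof. by rewrite mulrC; apply: killsMl. Qed.

Lemma killsD q q' : kills q -> kills q' -> kills (q + q').
Proof. by move=> kq kq' p; rewrite mulrDr linD kq kq' addr0. Qed.

Lemma killsB q q' : kills q -> kills q' -> kills (q - q').
Proof. by move=> kq kq' p; rewrite mulrBr linB kq kq' subr0. Qed.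

Lemma killsZ a q : kills q -> kills (a *: q).
Proof. by move=> kq p; rewrite -scalerAr linZ kq mulr0. Qed.

Lemma kills_sum (I : Type) (r : seq I) (Q : pred I) (f : I -> P) :
  (forall i, Q i -> kills (f i)) -> kills (\sum_(i <- r | Q i) f i).
Proof.
move=> kf; elim/big_rec: _ => [|i q Qi kq]; first exact: kills0.
by apply: killsD => //; apply: kf.
Qed.

Lemma killsBC q q' : kills (q - q') -> kills (q' - q).
Proof. by move=> k p; rewrite -opprB mulrN linN k oppr0. Qed.

Lemma killsB_trans q1 q2 q3 : kills (q1 - q2) -> kills (q2 - q3) -> kills (q1 - q3).
Proof. by move=> k k' p; rewrite -[q1](subrK q2) -addrA; apply: killsD. Qed.

Lemma kills_eq p q q' : kills (q - q') -> phi (p * q) = phi (p * q').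
Proof. by move=> /(_ p); rewrite mulrBr linB => /eqP; rewrite subr_eq0 => /eqP. Qed.

Lemma killsBX q q' k : kills (q - q') -> kills (q ^+ k - q' ^+ k).
Proof. by move=> kq; rewrite subrXX; apply: killsMr. Qed.
End Lin.

Definition chowfun M phi :=
  lin phi /\ forall g, chow_gen M g -> kills phi g.

Section Chowfun.
Variables (M : matroid E) (phi : P -> R).
Hypothesis cphi : chowfun M phi.
Let lphi : lin phi := cphi.1.

Lemma kills_xv F : ~~ npflat M F -> kills phi (xv R F).
Proof. by move=> nF; apply: cphi.2; left; exists F. Qed.

(** [F] and [G] may be arbitrary sets, because a variable outside the nonempty proper flats is
    already killed. *)
Lemma kills_xv2 F G : ~~ (F \subset G) -> ~~ (G \subset F) ->
  kills phi (xv R F * xv R G).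
Proof.
move=> FG GF; have [fF|/kills_xv k] := boolP (npflat M F); last exact: killsMr.
have [fG|/kills_xv k] := boolP (npflat M G); last exact: killsMl.
apply: cphi.2; right; left; exists [set F; G]; split.
  by apply/forall_inP => A /set2P[]->.
split.
  apply/negP => /is_chainP/(_ F G); rewrite !inE !eqxx orbT.
  by rewrite (negPf FG) (negPf GF) => /(_ isT isT).
rewrite /xmono big_setU1 ?big_set1 // inE.
by apply: contraNneq FG => ->.
Qed.

(** The linear relation for the difference of the coordinates [ord0] and [i]. *)
Lemma kills_alpha i :
  kills phi (alpha R M - \sum_(G | npflat M G && (i \in G)) xv R G).
Proof.
pose m j : int := (j == ord0)%:Z - (j == i)%:Z.
suff -> : alpha R M - \sum_(G | npflat M G && (i \in G)) xv R G =
    \sum_(F | npflat M F) (\sum_(j in F) m j)%:~R *: xv R F.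
  apply: cphi.2; right; right; exists m; split=> //.
  rewrite sumrB (bigD1 ord0) //= (bigD1 i (F := fun j => (j == i)%:Z)) //=.
  rewrite !big1 ?addr0 ?eqxx ?subrr // => j /negPf-> //.
have mk k : \sum_(G | npflat M G && (k \in G)) xv R G =
    \sum_(G | npflat M G) if k \in G then xv R G else 0 by rewrite big_mkcondr.
rewrite /alpha !mk -sumrB; apply: eq_bigr => F _.
have s k : \sum_(j in F) (j == k)%:Z = (k \in F)%:Z.
  have [kF|kF] := boolP (k \in F).
    by rewrite (bigD1 k) //= eqxx big1 // => j /andP[_ /negPf->].
  by rewrite big1 // => j jF; case: eqVneq kF => // <-; rewrite jF.
rewrite sumrB !s; case: (_ \in F); case: (_ \in F) => /=;
  by rewrite ?subrr ?subr0 ?sub0r ?scale0r ?scale1r ?mulrN1z ?scaleN1r.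
Qed.

(** Once [alpha] is written with an element [i] of [F], all flats above [F] cancel. *)
Lemma kills_hv i F : i \in F ->
  kills phi (hv R M F - \sum_(G | npflat M G && ((i \in G) && ~~ (F \subset G))) xv R G).
Proof.
move=> iF; have := kills_alpha i.
rewrite (bigID (fun G : {set E} => F \subset G) (fun G => npflat M G && _)) /=.
rewrite (eq_bigl (fun G : {set E} => npflat M G && (F \subset G))); last first.
  move=> G; have [sFG|] := boolP (F \subset G); rewrite ?andbF //.
  by rewrite (subsetP sFG) ?andbT.
rewrite opprD addrA; congr (kills _ (_ - _)).
by apply: eq_bigl => G; rewrite andbA.
Qed.

Hypothesis lM : loopless M.

(** Writing a factor [alpha] with an element outside [F] leaves only flats strictly above [F], so
    each factor raises the rank of the index until no proper flat is left. *)
Lemma kills_alphaX_xv j F : npflat M F -> (rk M setT <= rk M F + j)%N ->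
  kills phi (alpha R M ^+ j * xv R F).
Proof.
elim: j F => [|j IH] F fF rF.
  have /and3P[fF' _ FT] := fF; have := flat_proper_rk fF' (_ : F \proper setT).
  by rewrite properT FT => /(_ isT); lia.
have /and3P[fF' _ FT] := fF.
have /subsetPn[i _ iF] : ~~ ([set: E] \subset F) by rewrite subTset.
rewrite exprSr -mulrA.
have -> : alpha R M * xv R F =
    (alpha R M - \sum_(G | npflat M G && (i \in G)) xv R G) * xv R F
   + \sum_(G | npflat M G && (i \in G)) xv R F * xv R G.
  by rewrite mulrBl -mulr_sumr [xv R F * _]mulrC subrK.
rewrite mulrDr; apply: (killsD lphi).
  by apply: killsMl; apply: killsMr; apply: kills_alpha.
rewrite mulr_sumr; apply: (kills_sum lphi) => G /andP[fG iG].
have [sFG|nFG] := boolP (F \subset G).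
  rewrite mulrCA; apply: killsMl; apply: IH => //.
  have := flat_proper_rk fF' (_ : F \proper G).
  rewrite properE sFG (_ : ~~ _) => [/(_ isT)|]; first lia.
  by apply/subsetPn; exists i.
apply: killsMl; apply: kills_xv2 => //.
by apply/subsetPn; exists i.
Qed.

Lemma xmonoD1 S F : F \in S -> xmono R S = xv R F * xmono R (S :\ F).
Proof. exact: big_setD1. Qed.

(** A chain whose top has rank at most its length is saturated from the bottom. Its top variable can
    be traded for a factor [alpha], and repeating this leaves a pure power. Hence all maximal cones
    get the same value. *)
Lemma alphaX_xmono S k : is_chain S -> [forall F in S, npflat M F] ->
  (rk M (cover S) <= #|S|)%N -> (#|S| + k).+1 = rk M setT ->
  kills phi (alpha R M ^+ k * xmono R S - alpha R M ^+ (rk M setT).-1).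
Proof.
elim: {S}#|S| {-2}S k (leqnn #|S|) => [|c IH] S k.
  rewrite leqn0 => /eqP S0 _ _ _; rewrite S0 => <-.
  have -> : S = set0 by apply/eqP; rewrite -cards_eq0 S0.
  by rewrite /xmono big_set0 mulr1 subrr; apply: kills0.
move=> cardS cS fS rS rT; have [S0|S0] := eqVneq S set0.
  rewrite -rT S0 /xmono big_set0 cards0 mulr1 subrr; exact: kills0.
have [FS cS' fS' ltF] := chain_top lM cS fS S0.
have flU := chain_cover_flat lM cS' fS'.
have ltr := flat_proper_rk flU ltF.
have ler := chain_card_rk lM cS' fS'.
have card' : #|S| = #|S :\ cover S|.+1 by rewrite (cardsD1 (cover S)) FS.
set F := cover S in FS cS' fS' ltF flU ltr ler card' rS.
set U := cover (S :\ F) in ltF flU ltr ler.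
have fF : npflat M F by move/forall_inP: fS; apply.
have rU : (rk M U <= #|S :\ F|)%N.
  by rewrite -ltnS -card'; apply: leq_trans ltr rS.
have rF : (rk M F <= (rk M U).+1)%N by apply: leq_trans rS _; rewrite card'.
have := IH (S :\ F) k.+1 _ cS' fS' rU _.
rewrite -ltnS -card' => /(_ cardS); rewrite addnS -addSn -card' => /(_ rT).
apply: (killsB_trans lphi); apply: (killsBC lphi).
(* Expand [alpha] with an element of [F] outside the next lower flat [U]: the term at [F] cancels
   [xv R F], and every other term is killed. *)
have [_ [i iF iU]] := properP ltF.
have -> : alpha R M ^+ k.+1 * xmono R (S :\ F) - alpha R M ^+ k * xmono R S =
  alpha R M ^+ k * xmono R (S :\ F) * (alpha R M - xv R F).
  by rewrite (xmonoD1 FS) exprSr; ring.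
rewrite -[alpha R M - _](subrKA (\sum_(G | npflat M G && (i \in G)) xv R G)).
rewrite mulrDr; apply: (killsD lphi); first by apply/killsMl/kills_alpha.
rewrite (bigD1 F) ?fF //= [_ + _ - _]addrAC subrr add0r mulr_sumr.
apply: (kills_sum lphi) => G /andP[/andP[fG iG] neGF].
have [|] := boolP (U \subset G) => sUG.
  rewrite mulrAC; apply: killsMr; apply: kills_alphaX_xv => //.
  (* [F] is the closure of [i |: U], so a flat [G] containing [U] and [i] contains [F]. Being
     different from [F], it has larger rank, and [alpha ^+ k] annihilates its variable. *)
  have sFG : F \subset G.
    have fF' : flat M F by case/and3P: fF.
    have <- : cl M (i |: U) = F.
      apply: flat_eq_rk; first exact: flat_cl.
        by rewrite cl_min // subUset sub1set iF proper_sub.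
      rewrite rk_cl; apply: leq_trans rF _.
      by move/flatP: flU; apply.
    have /and3P[fG' _ _] := fG.
    by rewrite cl_min // subUset sub1set iG.
  have := flat_proper_rk (_ : flat M F) (_ : F \proper G).
  rewrite properEneq eq_sym neGF sFG; case/and3P: fF => -> _ _ /(_ isT isT).
  move=> rFG; rewrite -rT -addSn leq_add2r; apply: leq_ltn_trans rFG.
  by rewrite card'; apply: leq_ltn_trans ler ltr.
have [S'0|/(chain_cover cS')] := eqVneq (S :\ F) set0.
  by move: sUG; rewrite /U S'0 /cover big_set0 sub0set.
move=> US; rewrite (xmonoD1 US) -!mulrA; apply: killsMl.
rewrite mulrCA; apply: killsMl; rewrite mulrC; apply: kills_xv2; last by [].
by apply/subsetPn; exists i.
Qed.

End Chowfun.
End ChowFunctionals.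

(** * Principal truncation *)

Section Truncation.
Variable T : finType.
Implicit Types (M N : matroid T) (r : {set T} -> nat) (A B F G : {set T}).
Implicit Types (l : seq {set T}).
Local Open Scope nat_scope.

(** For [F] of positive rank this is the rank function of the principal truncation: the rank drops
    by one exactly on the sets whose closure contains [F]. It acts on plain functions, so that it
    can be iterated before the result is known to be a matroid. *)
Definition ptrunc F r A := minn (r A) (r (A :|: F)).-1.
Definition ptruncs l r := foldr ptrunc r l.

Lemma ptrunc_le F r A : ptrunc F r A <= r A.
Proof. exact: geq_minl. Qed.

(** Together with [ptruncs_attained] this makes the iterated truncation a minimum over [F]. Each
    member of [l] inside [F] is absorbed by [A :|: F] and contributes one unit. *)
Lemma ptruncs_ub l r A F : {homo r : B C / B \subset C >-> B <= C} ->
  ptruncs l r A <= r (A :|: F) - count (fun G : {set T} => G \subset F) l.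
Proof.
move=> hr; elim: l A => [|G l IH] A /=; first by rewrite subn0 hr ?subsetUl.
have [sGF|_] := boolP (G \subset F); last by rewrite (leq_trans (ptrunc_le _ _ _)).
rewrite /ptrunc geq_min; apply/orP; right; have := IH (A :|: G).
rewrite -setUA (setUidPr sGF); lia.
Qed.

(** [F] collects the members of [l] at which the second branch of the [minn] is taken. With the
    chain of flats as [Q], the minimum is attained on that chain. *)
Lemma ptruncs_attained l r A (Q : {set T} -> Prop) :
  Q set0 -> (forall F G, Q F -> G \in l -> Q (G :|: F)) ->
  exists F, Q F /\
    r (A :|: F) - count (fun G : {set T} => G \subset F) l <= ptruncs l r A.
Proof.
move=> Q0; elim: l A => [|G l IH] A QU /=.
  by exists set0; rewrite setU0 subn0.
have {}IH B : exists F, Q F /\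
    r (B :|: F) - count (fun G : {set T} => G \subset F) l <= ptruncs l r B.
  by apply: IH => F H QF Hl; apply: QU; rewrite // inE Hl orbT.
rewrite /ptrunc; case: leqP => _.
  by have [F [QF le]] := IH A; exists F; split=> //; lia.
have [F [QF le]] := IH (A :|: G); exists (G :|: F); split.
  by apply: QU; rewrite ?inE ?eqxx.
have := sub_count (_ : subpred (fun H : {set T} => H \subset F)
   (fun H => H \subset G :|: F)) l.
move=> /(_ (fun H sHF => subset_trans sHF (subsetUr G F))) cle.
by rewrite subsetUl setUA; lia.
Qed.

(** For each choice of branches on the right, the bound is submodularity of [A] or [A :|: F] against
    [B] or [B :|: F]. *)
Lemma ptrunc_matroid M F : 0 < rk M F ->
  exists N, rk N =1 ptrunc F (rk M).
Proof.
move=> F0.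
have card A : ptrunc F (rk M) A <= #|A| by rewrite (leq_trans (ptrunc_le _ _ _)) ?rk_card.
have mono A B : A \subset B -> ptrunc F (rk M) A <= ptrunc F (rk M) B.
  move=> sAB; have := rk_mono M sAB; have := rk_mono M (setSU F sAB).
  by rewrite /ptrunc; lia.
suff submod A B : ptrunc F (rk M) (A :|: B) + ptrunc F (rk M) (A :&: B)
    <= ptrunc F (rk M) A + ptrunc F (rk M) B by exists (Matroid card mono submod).
have h1 := rk_submod M A B.
have h2 := rk_submod M (A :|: F) (B :|: F).
have h3 := rk_submod M (A :|: F) B.
have h4 := rk_submod M A (B :|: F).
rewrite -setUUl -setUIl in h2.
rewrite setUAC in h3; rewrite setUA in h4.
have i3 : rk M (A :&: B) <= rk M ((A :|: F) :&: B) by rewrite rk_mono ?setSI ?subsetUl.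
have i4 : rk M (A :&: B) <= rk M (A :&: (B :|: F)) by rewrite rk_mono ?setIS ?subsetUl.
have p X : 0 < rk M (X :|: F) by apply: leq_trans F0 _; rewrite rk_mono ?subsetUr.
have := p A; have := p B; have := p (A :|: B); have := p (A :&: B).
by rewrite /ptrunc; lia.
Qed.

(** Ranks only decrease along the list, so positivity at the end gives looplessness at every
    intermediate stage. *)
Lemma ptruncs_matroid M l : loopless M -> set0 \notin l ->
  (forall x, 0 < ptruncs l (rk M) [set x]) ->
  exists N, loopless N /\ rk N =1 ptruncs l (rk M).
Proof.
move=> lM; elim: l => [|F l IH] /=; first by exists M.
rewrite inE negb_or eq_sym => /andP[F0 l0] pos.
have [x|N [lN eN]] := IH l0; first exact: leq_trans (pos x) (ptrunc_le _ _ _).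
have [|N' eN'] := @ptrunc_matroid N F; first by rewrite rk_gt0.
have eN'' A : rk N' A = ptrunc F (ptruncs l (rk M)) A by rewrite eN' /ptrunc !eN.
by exists N'; split=> //; apply: looplessP => x; rewrite eN''.
Qed.

(** A flat is lost only if it does not contain [F] and its join with [F] has rank one more; any
    element of [F] outside it then generates that join. *)
Lemma ptrunc_flat M N F G : rk N =1 ptrunc F (rk M) -> flat M G -> 0 < rk M F ->
  ~~ flat N G ->
  ~~ (F \subset G) /\ forall i, i \in F -> i \notin G -> F \subset cl M (i |: G).
Proof.
move=> eN fG rF /forallPn[x]; rewrite negb_imply -leqNgt => /andP[xG].
rewrite !eN /ptrunc.
have h0 := flatP _ _ fG x xG; have h1 := rk_mono M (subsetUr (x |: G) F).
have h2 := rkU1 M x G.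
have h3 : rk M (x |: G) <= rk M (x |: G :|: F) by rewrite rk_mono ?subsetUl.
have h4 := rk_mono M (subsetUl G F).
have h5 : rk M (G :|: F) <= rk M (x |: G :|: F) by rewrite rk_mono ?setSU ?subsetUr.
have h7 : rk M F <= rk M (G :|: F) by rewrite rk_mono ?subsetUr.
move=> h6; have sFG : ~~ (F \subset G).
  apply/negP => sFG; move: h6 h7; rewrite (setUidPl sFG).
  by rewrite (setUidPl (subset_trans sFG (subsetUr _ _))); lia.
split=> // i iF iG; have eqr : rk M (G :|: F) <= (rk M G).+1 by lia.
apply/subsetP => y yF; rewrite inE; have h8 := rk_mono M (subsetUr [set y] (i |: G)).
have := flatP _ _ fG i iG.
have : rk M (y |: (i |: G)) <= rk M (G :|: F).
  by rewrite rk_mono // !subUset !sub1set !inE iF yF !orbT subsetUl.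
by move=> h9 h10; apply/eqP; lia.
Qed.

Lemma ptrunc_quotient M N F : 0 < rk M F -> rk N =1 ptrunc F (rk M) -> quotient N M.
Proof.
move=> rF eN G /flatP fG; apply/flatP => x xG.
have := fG x xG; rewrite !eN /ptrunc.
have := rk_mono M (subsetUr [set x] G); have := rk_dimret M [set x] (subsetUl G F).
rewrite -[x |: G :|: F]setUA [x |: (G :|: F)]setUC [x |: G]setUC.
have : 0 < rk M (G :|: F) by apply: leq_trans rF _; rewrite rk_mono ?subsetUr.
lia.
Qed.

End Truncation.

(** * Degree functionals and their passage to a truncation *)

Section Degree.
Variables (R : comNzRingType) (n : nat).
Local Notation E := ('I_n.+1).
Local Notation P := (cpoly R n).
Implicit Types (M N : matroid E) (F G : {set E}) (S : {set {set E}}) (p q : P).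
Implicit Types (phi : P -> R).

(** Normalising on [alpha ^+ d] instead of on the maximal cones passes more easily to truncations.
    By [degfun_degf] and [degf_degfun] the two forms agree on loopless matroids of rank [d.+1]. *)
Definition degf M d phi := chowfun M phi /\ phi (alpha R M ^+ d) = 1.

Lemma cone_cover M d S : cone M d S -> rk M setT = d.+1 -> (rk M (cover S) <= #|S|)%N.
Proof.
case/and3P=> cS /forall_inP fS /eqP cardS rT.
have [->|/(chain_cover cS)/fS/and3P[fU _ UT]] := eqVneq S set0.
  by rewrite /cover big_set0 rk0.
have := flat_proper_rk fU (_ : _ \proper setT); rewrite properT UT => /(_ isT).
by rewrite rT cardS.
Qed.

Lemma cone_kills M d phi S : loopless M -> rk M setT = d.+1 -> chowfun M phi ->
  cone M d S -> kills phi (xmono R S - alpha R M ^+ d).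
Proof.
move=> lM rT cphi cS; have rU := cone_cover cS rT; case/and3P: cS => cS fS /eqP cardS.
have := alphaX_xmono cphi lM (k := 0) cS fS rU.
by rewrite addn0 cardS rT mul1r => /(_ erefl).
Qed.

Lemma cone_val M d phi S : loopless M -> rk M setT = d.+1 -> degf M d phi ->
  cone M d S -> phi (xmono R S) = 1.
Proof.
move=> lM rT [cphi <-] /(cone_kills lM rT cphi) k.
by have := kills_eq cphi.1 1 k; rewrite !mul1r.
Qed.

Lemma bergman_cone M d S : rk M setT = d.+1 -> cone M d S -> bergman R M S = 1.
Proof. by move=> rT /and3P[cS fS dS]; rewrite /bergman cS fS rT dS. Qed.

Lemma degfun_degf M d phi : loopless M -> rk M setT = d.+1 ->
  degfun M d phi -> degf M d phi.
Proof.
move=> lM rT [lphi iphi vphi].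
have cphi : chowfun M phi.
  split=> // g gg p; apply: iphi; exists [:: (p, g)]; split.
    by move=> q; rewrite inE => /eqP->.
  by rewrite big_seq1.
split=> //; have [S] := flag_exists lM; rewrite rT /= => cS.
have := kills_eq cphi.1 1 (cone_kills lM rT cphi cS); rewrite !mul1r => <-.
by rewrite vphi // (bergman_cone rT).
Qed.

Lemma degf_degfun M d phi : loopless M -> rk M setT = d.+1 ->
  degf M d phi -> degfun M d phi.
Proof.
move=> lM rT dphi; have [cphi _] := dphi; split; first exact: cphi.1.
  move=> _ [s [gs ->]]; rewrite (lin_sum cphi.1) big_seq big1 // => q qs.
  by apply: cphi.2; apply: gs.
by move=> S cS; rewrite (cone_val lM rT dphi) // (bergman_cone rT).
Qed.

(** Flats of [M] that are lost in [M'] contribute only killed variables. This transports linear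
    relations, [alpha] and [hv] between the two matroids. *)
Lemma kills_quotient M' M phi (Q : pred {set E}) (c : {set E} -> R) :
  lin phi -> quotient M' M ->
  (forall G, npflat M G -> ~~ npflat M' G -> kills phi (xv R G)) ->
  kills phi (\sum_(G | npflat M G && Q G) c G *: xv R G
           - \sum_(G | npflat M' G && Q G) c G *: xv R G).
Proof.
move=> lphi q k; rewrite (bigID (npflat M')) /=.
rewrite (eq_bigl (fun G => npflat M' G && Q G)); last first.
  move=> G; have [f'|] := boolP (npflat M' G); rewrite ?andbF // andbT.
  by rewrite (quotient_npflat q).
rewrite [_ + _ - _]addrAC subrr add0r; apply: (kills_sum lphi) => G /andP[/andP[f _] f'].
by apply: (killsZ lphi); apply: k.
Qed.

Lemma kills_quotient1 M' M phi (Q : pred {set E}) :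
  lin phi -> quotient M' M ->
  (forall G, npflat M G -> ~~ npflat M' G -> kills phi (xv R G)) ->
  kills phi (\sum_(G | npflat M G && Q G) xv R G
           - \sum_(G | npflat M' G && Q G) xv R G).
Proof.
move=> lphi q /(kills_quotient Q (fun=> 1) lphi q).
by under eq_bigr do rewrite scale1r; under [X in _ - X]eq_bigr do rewrite scale1r.
Qed.

Lemma kills_hv_quotient M' M phi F : chowfun M' phi -> quotient M' M ->
  kills phi (hv R M F - hv R M' F).
Proof.
move=> cphi q; have k G : npflat M G -> ~~ npflat M' G -> kills phi (xv R G).
  by move=> _; apply: kills_xv.
have -> : hv R M F - hv R M' F = (alpha R M - alpha R M') -
    (\sum_(G | npflat M G && (F \subset G)) xv R G
     - \sum_(G | npflat M' G && (F \subset G)) xv R G) by rewrite /hv; ring.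
apply: (killsB cphi.1); exact: kills_quotient1 cphi.1 q k.
Qed.

(** The factor [hv] is taken in [M] while [M'] is an intermediate truncation, so that the lemma
    iterates over a product of fixed factors. *)
Lemma degf_ptrunc M M' N d phi F :
  loopless M' -> loopless N -> quotient M' M -> rk M' setT = d.+2 ->
  rk N =1 ptrunc F (rk M') -> (1 < rk M' F)%N ->
  degf M' d.+1 phi -> degf N d (fun p => phi (p * hv R M F)).
Proof.
move=> lM' lN qM rT eN rF [cphi phi1]; have lphi := cphi.1.
have rF0 : (0 < rk M' F)%N by apply: ltnW.
have qN : quotient N M' := ptrunc_quotient rF0 eN.
have kh := kills_hv_quotient F cphi qM.
pose phi' p := phi (p * hv R M F); have lphi' : lin phi' := lin_mulr lphi _.
have kk' g : kills phi g -> kills phi' g.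
  by move=> kg p; rewrite /phi' mulrAC; apply: kg.
(* For [i] in [F] outside the lost flat [G], expand [hv] over flats [H] containing [i] but not [F].
   Such an [H] is not inside [G], and above [G] it would contain [cl M' (i |: G)], hence [F]. So
   [xv R G * xv R H] is killed. *)
have kx G : npflat M' G -> ~~ npflat N G -> kills phi' (xv R G).
  move=> fG nfG; have /and3P[fG' G0 GT] := fG.
  have nN : ~~ flat N G by move: nfG; rewrite /npflat G0 GT !andbT.
  have [nFG clF] := ptrunc_flat eN fG' rF0 nN.
  have /subsetPn[i iF iG] := nFG.
  suff : kills phi (xv R G * hv R M F) by move=> k p; rewrite /phi' -mulrA k.
  have {}kh := killsB_trans lphi kh (kills_hv cphi iF).
  rewrite -[hv R M F](subrK (\sum_(G | npflat M' G && ((i \in G) && ~~ (F \subset G))) xv R G)).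
  rewrite mulrDr; apply: (killsD lphi); first exact: killsMl.
  rewrite mulr_sumr; apply: (kills_sum lphi) => H /andP[/and3P[fH _ _] /andP[iH nFH]].
  apply: (kills_xv2 cphi); last by apply/subsetPn; exists i.
  apply: contra nFH => sGH; apply: subset_trans (clF i iF iG) _.
  by rewrite cl_min // subUset sub1set iH.
have cphi' : chowfun N phi'.
  split=> // g [[G [nG ->]]|[[S [fS [nS ->]]]|[m [m0 ->]]]].
  - have [fG|nfG] := boolP (npflat M' G); first exact: kx.
    exact: kk' (kills_xv cphi nfG).
  - apply/kk'/cphi.2; right; left; exists S; split=> //.
    by apply/forall_inP => A AS; apply: (quotient_npflat qN); move/forall_inP: fS; apply.
  have := @kills_quotient N M' phi' predT (fun G => (\sum_(i in G) m i)%:~R) lphi' qN kx.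
  rewrite !(eq_bigl _ _ (fun=> andbT _)) => /(killsBC lphi') k.
  have kM : kills phi' (\sum_(G | npflat M' G) (\sum_(i in G) m i)%:~R *: xv R G).
    by apply/kk'/cphi.2; right; right; exists m.
  by rewrite -[X in kills _ X](subrK (\sum_(G | npflat M' G) (\sum_(i in G) m i)%:~R *: xv R G));
    apply: (killsD lphi').
split=> //; change (phi' (alpha R N ^+ d) = 1).
have ka : kills phi' (alpha R N - alpha R M').
  by apply: (killsBC lphi'); apply: (kills_quotient1 (fun G : {set E} => ord0 \in G)).
have := kills_eq lphi' 1 (killsBX d ka); rewrite !mul1r => ->.
(* [alpha] and [hv] differ by variables of flats of rank at least 2, which [alpha ^+ d] annihilates
   since the total rank is [d.+2]. *)
rewrite /phi' (kills_eq lphi _ kh) /hv mulrBr -exprSr (linB lphi) phi1.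
rewrite mulr_sumr (lin_sum lphi) big1 ?subr0 // => G /andP[fG sFG].
have := kills_alphaX_xv cphi fG (j := d); rewrite rT.
have := rk_mono M' sFG => rFG; rewrite -[X in phi X]mul1r => -> //; lia.
Qed.

End Degree.

(** * Nested sequences of flats *)

Section NestedSequences.
Variable n : nat.
Local Notation E := ('I_n.+1).
Implicit Types (M N : matroid E) (A F G : {set E}) (s : seq ({set E} * nat)).
Local Open Scope nat_scope.

Local Notation supp s := (map (@fst {set E} nat) s).

Definition expand s : seq {set E} := flatten [seq nseq p.2 p.1 | p <- s].
(** On a flat of the truncated matroid this number is the nullity, by [nested_flat_nullity]. *)
Definition expo s F := count (fun G => G \subset F) (expand s).

Lemma expo_cons p s F : expo (p :: s) F = (p.1 \subset F) * p.2 + expo s F.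
Proof. by rewrite /expo /= count_cat count_nseq. Qed.

Lemma size_expand s : size (expand s) = sumn (map snd s).
Proof. by elim: s => //= p s IH; rewrite size_cat size_nseq IH. Qed.

Lemma mem_expand s F : F \in expand s -> F \in supp s.
Proof.
case/flattenP => t /mapP[p ps ->]; rewrite mem_nseq => /andP[_ /eqP->].
exact: map_f.
Qed.

Lemma expo_mono s F G : F \subset G -> expo s F <= expo s G.
Proof. by move=> sFG; apply: sub_count => H sHF; apply: subset_trans sHF sFG. Qed.

Lemma nested_path_proper M p s : path (nested_rel M) p s ->
  all (fun q : {set E} * nat => p.1 \proper q.1) s.
Proof.
elim: s p => //= q s IH p /andP[/and3P[pq _ _] /IH qs]; rewrite pq /=.
by apply: sub_all qs => t; apply: proper_trans.
Qed.

Lemma nested_path_mem M p s F : path (nested_rel M) p s ->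
  F \in supp s -> p.1 \proper F.
Proof. by move=> /nested_path_proper/allP h /mapP[q qs ->]; apply: h. Qed.

Lemma nested_path_sub M p s F : path (nested_rel M) p s ->
  F \in p.1 :: supp s -> p.1 \subset F.
Proof.
move=> ps; rewrite inE => /predU1P[->//|].
by move/(nested_path_mem ps)/proper_sub.
Qed.

Lemma nested_path_chain M p s F G : path (nested_rel M) p s ->
  F \in p.1 :: supp s -> G \in p.1 :: supp s -> (F \subset G) || (G \subset F).
Proof.
elim: s p => [|q s IH] p ps; first by rewrite !inE => /eqP-> /eqP->; rewrite subxx.
move: (ps); rewrite /= => /andP[_ qs].
rewrite inE => /predU1P[->|Fs]; first by move/(nested_path_sub ps)->.
rewrite inE => /predU1P[->|Gs]; last exact: IH qs Fs Gs.
by rewrite (nested_path_sub ps) ?orbT // inE Fs orbT.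
Qed.

Lemma expo_path0 M p s : path (nested_rel M) p s -> expo s p.1 = 0.
Proof.
elim: s p => //= q s IH p /andP[pq qs]; rewrite expo_cons.
have /and3P[ppq _ _] := pq; rewrite (negPf (proper_subn ppq)) mul0n add0n.
apply/eqP; rewrite -leqn0 -(IH _ qs); apply: expo_mono; exact: proper_sub.
Qed.

(** The two inequalities accumulate, along the chain, the lower and the upper bound on each
    exponent. *)
Lemma expo_path M p s F G : path (nested_rel M) p s ->
  F \in p.1 :: supp s -> G \in p.1 :: supp s -> F \proper G ->
  expo s F < expo s G /\ expo s G + rk M F < rk M G + expo s F.
Proof.
elim: s p F G => [|q s IH] p F G ps.
  by rewrite !inE => /eqP-> /eqP->; rewrite properxx.
have e0 := expo_path0 ps; move: (ps) => /= /andP[/and3P[pq q0 qr] qs].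
have eq0 := expo_path0 qs.
rewrite inE => /predU1P[->|Fs].
  rewrite inE => /predU1P[->|Gs]; first by rewrite properxx.
  move=> _; rewrite e0 expo_cons (nested_path_sub qs Gs) mul1n.
  have [<-|neq] := eqVneq q.1 G; first by rewrite eq0; lia.
  have := IH _ _ _ qs (mem_head _ _) Gs; rewrite properEneq neq.
  by rewrite (nested_path_sub qs Gs) eq0 => /(_ isT); lia.
rewrite inE => /predU1P[->|Gs].
  move/proper_subn; rewrite (nested_path_sub ps) // inE Fs orbT //.
move=> ltFG; have := IH _ _ _ qs Fs Gs ltFG.
rewrite !expo_cons !(nested_path_sub qs) //; lia.
Qed.

Lemma ptruncs_quotient M l N : loopless M -> set0 \notin l -> loopless N ->
  rk N =1 ptruncs l (rk M) -> quotient N M.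
Proof.
move=> lM; elim: l N => [|F l IH] N /= l0 lN eN.
  by move=> G; rewrite (eq_rk_flat eN).
move: l0; rewrite inE negb_or eq_sym => /andP[F0 l0].
have [|N' [lN' eN']] := ptruncs_matroid lM l0.
  by move=> x; apply: leq_trans (ptrunc_le F _ _); rewrite -eN lN.
apply: quotient_trans (IH _ l0 lN' eN').
by apply: (@ptrunc_quotient _ _ _ F); rewrite ?rk_gt0 // => A; rewrite eN /ptrunc !eN'.
Qed.

Lemma ptruncsT l (r : {set E} -> nat) : ptruncs l r setT = r setT - size l.
Proof. by elim: l => [|F l IH] /=; rewrite ?subn0 // /ptrunc setTU IH; lia. Qed.

Lemma nullity_nat N M A : quotient N M -> nullity N M A = (rk M A - rk N A)%:Z.
Proof.
move=> q; rewrite /nullity subzn //.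
by have := quotient_rk q (sub0set A); rewrite !rk0 addn0.
Qed.

Section Nested.
Variables (M : matroid E) (s : seq ({set E} * nat)).
Hypotheses (lM : loopless M) (fs : all (fun p => flat M p.1) s)
  (ps : path (nested_rel M) (set0, 0) s).
Local Notation Fs := (set0 :: supp s).

Lemma nested_flat F : F \in Fs -> flat M F.
Proof.
by rewrite inE => /predU1P[->|/mapP[p /(allP fs) fp ->//]]; apply: flat0.
Qed.

Lemma nested_expo_lt F : F \in supp s -> expo s F < rk M F.
Proof.
move=> FFs; have p0 : set0 \proper F := nested_path_mem ps FFs.
have := expo_path ps (mem_head _ _) (_ : F \in Fs) p0.
by rewrite inE FFs orbT (expo_path0 ps) rk0 !addn0 => /(_ isT)[].
Qed.

Lemma nested_expo_le F : F \in Fs -> expo s F <= rk M F.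
Proof.
rewrite inE => /predU1P[->|/nested_expo_lt/ltnW//].
by rewrite (expo_path0 ps).
Qed.

Lemma nested_chain F G : F \in Fs -> G \in Fs -> (F \subset G) || (G \subset F).
Proof. exact: nested_path_chain ps. Qed.

Lemma set0_expand : set0 \notin expand s.
Proof.
apply/negP => /mem_expand/(nested_path_mem ps).
by rewrite properxx.
Qed.

Lemma nested_ub A F : ptruncs (expand s) (rk M) A <= rk M (A :|: F) - expo s F.
Proof. by apply: ptruncs_ub; apply: rk_mono. Qed.

(** The members of a chain are closed under union, so the minimum defining the truncated rank is
    attained on the chain. *)
Lemma nested_attained A : exists2 F : {set E}, F \in Fs &
  rk M (A :|: F) - expo s F <= ptruncs (expand s) (rk M) A.
Proof.
have [||F [FFs le]] := @ptruncs_attained _ (expand s) (rk M) A (fun F => F \in Fs);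
  [by rewrite mem_head| | by exists F].
move=> F G FFs /mem_expand GFs; have {}GFs : G \in Fs by rewrite inE GFs orbT.
by case/orP: (nested_chain FFs GFs) => [/setUidPl->|/setUidPr->].
Qed.

Lemma nested_pos x : 0 < ptruncs (expand s) (rk M) [set x].
Proof.
have [F FFs le] := nested_attained [set x]; apply: leq_trans le.
move: FFs; rewrite inE => /predU1P[->|/nested_expo_lt lt].
  by rewrite setU0 (expo_path0 ps) lM.
by rewrite subn_gt0 (leq_trans lt) // rk_mono ?subsetUr.
Qed.

Lemma nested_matroid : exists N, loopless N /\ rk N =1 ptruncs (expand s) (rk M).
Proof. by apply: ptruncs_matroid lM set0_expand nested_pos. Qed.

Variable N : matroid E.
Hypothesis (lN : loopless N) (eN : rk N =1 ptruncs (expand s) (rk M)).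

Lemma nested_quotient : quotient N M.
Proof. exact: ptruncs_quotient lM set0_expand lN eN. Qed.

(** The chain member attaining the minimum lies inside [G], since an element of it outside [G] could
    be added without raising [rk N]. Comparison with the bound at [G] itself gives both claims. *)
Lemma nested_flat_nullity G : flat N G -> rk M G = rk N G + expo s G /\
  exists F : {set E}, [/\ F \in Fs, F \subset G & expo s F = expo s G].
Proof.
move=> fG; have [F FFs] := nested_attained G; rewrite -eN => leF.
have sFG : F \subset G.
  apply/negPn/negP => /subsetPn[x xF xG]; have := flatP _ _ fG x xG.
  have := nested_ub (x |: G) F; rewrite -eN.
  rewrite [x |: G]setUC -setUA [[set x] :|: F](setUidPr _) ?sub1set // => le1 lt1.
  by have := leq_trans lt1 (leq_trans le1 leF); rewrite ltnn.
have := nested_ub G G; rewrite -eN setUid => leG.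
rewrite (setUidPl sFG) in leF; have mF := expo_mono s sFG.
have lF := nested_expo_le FFs; have rF := rk_mono M sFG.
(* The empty flat is separate because undoing the truncated subtraction needs positive rank. *)
have [G0|G0] := eqVneq G set0.
  split; last by exists set0; rewrite mem_head sub0set G0.
  by rewrite G0 !rk0 (expo_path0 ps).
have := rk_gt0 G lN; rewrite G0 => pG.
by split; [lia|exists F; split=> //; lia].
Qed.

(** A new element pushes every candidate for the minimum above the value at [F]: inside [F] the rank
    grows, and above [F] the rank exceeds that of [F] by more than the exponents do. *)
Lemma nested_flatN F : F \in Fs -> flat N F.
Proof.
move=> FFs; apply/flatP => x xF; have := nested_ub F F; rewrite setUid -!eN => leF.
have [G GFs] := nested_attained (x |: F); rewrite -eN.
have eF := nested_expo_le FFs; have eG := nested_expo_le GFs.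
have xrF := flatP _ _ (nested_flat FFs) x xF.
have [sGF|nGF] := boolP (G \subset F).
  rewrite (setUidPl (subset_trans sGF (subsetUr _ _))).
  have := expo_mono s sGF; lia.
have pFG : F \proper G.
  by rewrite properE nGF andbT; have := nested_chain FFs GFs; rewrite (negPf nGF) orbF.
have [_] := expo_path ps FFs GFs pFG.
have := rk_mono M (subsetUr (x |: F) G); lia.
Qed.

(** On flats of [N] the nullity is [expo]. Every flat shares this value with a chain member inside
    it, and along the chain it increases strictly. *)
Lemma nested_fcyclic G : fcyclic N M G <-> G \in Fs.
Proof.
have nul H : flat N H -> nullity N M H = (expo s H)%:Z.
  move=> /nested_flat_nullity[e _].
  by rewrite (nullity_nat _ nested_quotient) e addKn.
split=> [[fG minG]|GFs].
  have [_ [F [FFs sFG eF]]] := nested_flat_nullity fG.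
  have [<-//|neq] := eqVneq F G; have fF := nested_flatN FFs.
  by case: (minG F fF); rewrite ?properEneq ?neq // !nul // eF.
have fG := nested_flatN GFs; split=> // H fH pHG; rewrite !nul //.
have [_ [F [FFs sFH <-]]] := nested_flat_nullity fH.
have [] := expo_path ps FFs GFs (sub_proper_trans sFH pHG).
by move=> lt _ [e]; rewrite e ltnn in lt.
Qed.

Lemma nested_rel_nested : rel_nested N M.
Proof.
move=> F G /nested_fcyclic FFs /nested_fcyclic GFs.
exact/orP/nested_chain.
Qed.

End Nested.

(** The order by inclusion recovers the flats from the support, and the jumps of [expo] recover the
    exponents one after another. *)
Lemma nested_eq M s s' : path (nested_rel M) (set0, 0) s ->
  path (nested_rel M) (set0, 0) s' -> supp s =i supp s' ->
  {in supp s, expo s =1 expo s'} -> s = s'.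
Proof.
have srt t : path (nested_rel M) (set0, 0) t -> sorted (fun F G : {set E} => F \proper G) (supp t).
  move=> /path_sorted; rewrite sorted_map; apply: sub_sorted => p q /and3P[] //.
move=> ps ps' eqi eqe.
have eqf : supp s = supp s'.
  apply: irr_sorted_eq eqi; try exact: srt.
    by move=> A B C; apply: proper_trans.
  exact: properxx.
move: eqe {eqi}; elim: s s' (set0, 0) {1}(set0, 0) ps ps' eqf
  => [|p s IH] [|p' s'] //= q q' /andP[_ ps] /andP[_ ps'] [e1 e2] eqe.
have e : p = p'.
  have := eqe p.1 (mem_head _ _); rewrite !expo_cons (expo_path0 ps).
  rewrite e1 (expo_path0 ps') subxx !mul1n !addn0.
  by move: e1; case: (p) (p') => [? ?] [? ?] /= -> ->.
congr (_ :: _) => //; apply: (IH _ _ _ ps ps' e2) => F Fs.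
have := eqe F; rewrite inE Fs orbT !expo_cons e => /(_ isT)/eqP.
by rewrite eqn_add2l => /eqP.
Qed.

End NestedSequences.

(** * From a relative nested quotient back to a nested sequence *)

Section NestedOfQuotient.
Variable n : nat.
Local Notation E := ('I_n.+1).
Local Notation supp s := (map (@fst {set E} nat) s).
Implicit Types (A B C F G : {set E}) (cs : seq {set E}).
Local Open Scope nat_scope.

Variables (M M' : matroid E).
Hypotheses (lM : loopless M) (lM' : loopless M') (q : quotient M' M).

Definition nul A := rk M A - rk M' A.

Lemma rk_quotient_le A : rk M' A <= rk M A.
Proof. by have := quotient_rk q (sub0set A); rewrite !rk0 addn0. Qed.

Lemma nul_mono A B : A \subset B -> nul A <= nul B.
Proof.
move=> sAB; have := quotient_rk q sAB; rewrite /nul.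
by have := rk_quotient_le A; have := rk_quotient_le B; lia.
Qed.

Lemma rk_nul A : rk M A = rk M' A + nul A.
Proof. by rewrite /nul subnKC // rk_quotient_le. Qed.

Definition fcycb F :=
  flat M' F && [forall G : {set E}, flat M' G && (G \proper F) ==> (nul G != nul F)].

Lemma fcycP F : reflect (fcyclic M' M F) (fcycb F).
Proof.
apply: (iffP andP) => -[fF h]; split=> //.
  move=> G fG pG; rewrite !nullity_nat // => -[e].
  by move/forallP/(_ G): h; rewrite fG pG /nul e eqxx.
apply/forallP => G; apply/implyP => /andP[fG pG]; apply/eqP => e.
by apply: (h G fG pG); rewrite !nullity_nat // -!/(nul _) e.
Qed.

(** Take a flat of least cardinality among those inside [G] with the same nullity. *)
Lemma fcyc_below G : flat M' G -> exists C : {set E}, [/\ fcycb C, C \subset G & nul C = nul G].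
Proof.
move=> fG.
have [|C /and3P[fC sC /eqP eC] minC] := @arg_minnP _ G
  (fun C => [&& flat M' C, C \subset G & nul C == nul G]) (fun C => #|C|).
  by rewrite fG subxx eqxx.
exists C; split=> //; rewrite /fcycb fC; apply/forallP => F; apply/implyP.
case/andP=> fF pF; apply: contraL (proper_card pF) => /eqP eF; rewrite -leqNgt.
by apply: minC; rewrite fF eF eC eqxx (subset_trans (proper_sub pF)).
Qed.

Lemma fcyc0 : fcycb set0.
Proof.
by rewrite /fcycb flat0 //; apply/forallP => G; rewrite properE subset0 sub0set !andbF.
Qed.

(** Minimality forbids equal nullities, so the jump is positive. It is smaller than the jump of
    [rk M] because [rk M'] also increases strictly between its flats. *)
Lemma fcyc_step F G : fcycb F -> fcycb G -> F \proper G ->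
  (0 < nul G - nul F) && (nul G - nul F < rk M G - rk M F).
Proof.
move=> /andP[fF _] /andP[fG /forallP/(_ F)]; rewrite fF => /= h pFG.
move: h; rewrite pFG /= => neq.
have := flat_proper_rk fF pFG; have := nul_mono (proper_sub pFG).
have := rk_nul F; have := rk_nul G; lia.
Qed.

(** The exponents are the jumps of the nullity, so that [expo] telescopes back to it. *)
Definition seq_of (F0 : {set E}) cs := pairmap (fun F G => (G, nul G - nul F)) F0 cs.

Lemma supp_seq_of F0 cs : supp (seq_of F0 cs) = cs.
Proof. by elim: cs F0 => //= C cs IH F0; rewrite IH. Qed.

Lemma nested_seq_of F0 a cs : all fcycb (F0 :: cs) ->
  path (fun F G : {set E} => F \proper G) F0 cs ->
  path (nested_rel M) (F0, a) (seq_of F0 cs).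
Proof.
elim: cs F0 a => //= C cs IH F0 a /and3P[cF cC ccs] /andP[pFC pC].
by rewrite /nested_rel /= pFC fcyc_step //; apply: IH => //=; apply/andP.
Qed.

Lemma expo_seq_of F0 cs C : all fcycb (F0 :: cs) ->
  path (fun F G : {set E} => F \proper G) F0 cs -> C \in F0 :: cs ->
  expo (seq_of F0 cs) C = nul C - nul F0.
Proof.
elim: cs F0 C => [|G cs IH] F0 C; first by rewrite inE => _ _ /eqP->; rewrite subnn.
move=> ca pa; have na := nested_seq_of 0 ca pa.
rewrite inE => /predU1P[->|CG]; first by rewrite (expo_path0 na) subnn.
move: ca pa => /= /and3P[cF cG ccs] /andP[pFG pG].
have ca' : all fcycb (G :: cs) by rewrite /= cG.
rewrite expo_cons IH //.
have sGC : G \subset C.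
  by apply: (nested_path_sub (nested_seq_of 0 ca' pG)); rewrite supp_seq_of.
rewrite sGC mul1n /=.
by have := nul_mono sGC; have := nul_mono (proper_sub pFG); lia.
Qed.

Lemma sumn_seq_of F0 cs : all fcycb (F0 :: cs) ->
  path (fun F G : {set E} => F \proper G) F0 cs ->
  sumn (map snd (seq_of F0 cs)) = nul (last F0 cs) - nul F0 /\ nul F0 <= nul (last F0 cs).
Proof.
elim: cs F0 => [|C cs IH] F0 /=; first by rewrite subnn.
case/and3P=> cF cC ccs /andP[/proper_sub/nul_mono pFC pC].
by have [|-> //] := IH C _ pC; [exact/andP|lia].
Qed.

(** The nonempty f-cyclic flats are sorted by inclusion; [set0] is f-cyclic as well and serves as
    the starting point of the path. *)
Lemma fcyc_seq : rel_nested M' M -> exists cs,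
  [/\ all fcycb (set0 :: cs), path (fun F G : {set E} => F \proper G) set0 cs
    & forall C, fcycb C -> C \in set0 :: cs].
Proof.
move=> rn; pose le (F G : {set E}) := F \subset G.
pose e := enum [set F : {set E} | fcycb F & F != set0].
have ce : all fcycb e by apply/allP => F; rewrite mem_enum inE => /andP[].
have srt : sorted le (sort le e).
  apply: (sort_sorted_in (P := fcycb)) ce => F G /fcycP cF /fcycP cG.
  by case: (rn F G cF cG) => h; rewrite /le h ?orbT.
have letr : transitive le by move=> A B C; apply: subset_trans.
exists (sort le e); split.
- by rewrite /= fcyc0; apply/allP => F; rewrite mem_sort; move/allP: ce; apply.
- apply: (pairwise_sorted (s := set0 :: _)); rewrite pairwise_cons; apply/andP; split.
    by apply/allP => F; rewrite mem_sort mem_enum inE proper0 => /andP[].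
  rewrite (sorted_pairwise letr) in srt.
  have un : uniq (sort le e) by rewrite sort_uniq enum_uniq.
  rewrite uniq_pairwise in un.
  have := conj srt un => /andP; rewrite -pairwise_relI; apply: sub_pairwise.
  by move=> F G /= /andP[sFG neq]; rewrite properEneq neq.
move=> C cC; rewrite inE mem_sort mem_enum inE cC.
by case: eqVneq.
Qed.

(** Monotone nullity gives [rk M' A <= rk M (A :|: F) - nul F] for every [F]. Equality is reached at
    an f-cyclic flat inside [cl M' A] with the same nullity as that closure. *)
Lemma quotient_ptruncs s : path (nested_rel M) (set0, 0) s ->
  (forall C, fcycb C -> C \in set0 :: supp s) ->
  {in set0 :: supp s, expo s =1 nul} ->
  rk M' =1 ptruncs (expand s) (rk M).
Proof.
move=> ps memC expoE A; apply/eqP; rewrite eqn_leq; apply/andP; split.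
  have [F Fs] := nested_attained ps A; apply: leq_trans.
  rewrite expoE //; apply: leq_trans (leq_sub2l _ (nul_mono (subsetUr A F))).
  by rewrite rk_nul addnK rk_mono ?subsetUl.
have [C [cC sC eC]] := fcyc_below (flat_cl M' A).
have := nested_ub M s A C; rewrite expoE ?memC // eC => /leq_trans; apply.
rewrite -[rk M' A]rk_cl leq_subLR addnC -rk_nul rk_mono //.
by rewrite subUset sub_cl.
Qed.

Lemma nested_of_quotient c : rel_nested M' M ->
  rk M' setT = rk M setT - c -> c <= rk M setT ->
  exists s, nested M c s /\ rk M' =1 ptruncs (expand s) (rk M).
Proof.
move=> rn rT cle; have [cs [ca pa memC]] := fcyc_seq rn.
have nul0 : nul set0 = 0 by rewrite /nul !rk0.
pose s := seq_of set0 cs; have ps : path (nested_rel M) (set0, 0) s.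
  exact: nested_seq_of.
have eqs : supp s = cs by apply: supp_seq_of.
have expoE : {in set0 :: supp s, expo s =1 nul}.
  by move=> F; rewrite eqs => /(expo_seq_of ca pa)->; rewrite nul0 subn0.
exists s; split; last by apply: quotient_ptruncs => //; rewrite eqs.
have nT : nul setT = c by rewrite /nul rT; lia.
split=> //.
  apply/allP => p ps'; apply: q; have : p.1 \in cs by rewrite -eqs map_f.
  by move: ca => /= /andP[_ /allP ca] /ca /andP[].
have [-> _] := sumn_seq_of ca pa; rewrite nul0 subn0.
(* The exponents sum to the nullity of the last flat, at most [nul setT], which is [c]. An f-cyclic
   flat with the nullity of [setT] gives the reverse inequality. *)
apply/eqP; rewrite eqn_leq -{1}nT nul_mono ?subsetT //=.
have [C [cC _ eC]] := fcyc_below (flatT M').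
have [e0 _] := sumn_seq_of ca pa.
rewrite -(subn0 (nul (last _ _))) -nul0 -e0 -size_expand -nT -eC -expoE ?eqs ?memC //.
exact: count_size.
Qed.

End NestedOfQuotient.

(** * Evaluating the caps of nested monomials on cones *)

Section Evaluation.
Variables (R : comNzRingType) (n : nat).
Local Notation E := ('I_n.+1).
Local Notation P := (cpoly R n).
Local Notation supp s := (map (@fst {set E} nat) s).
Implicit Types (M N : matroid E) (F G : {set E}) (S : {set {set E}}) (p q : P).
Implicit Types (phi : P -> R).

Lemma degf_ext M d phi phi' : phi =1 phi' -> degf M d phi -> degf M d phi'.
Proof.
move=> e [[l k] v]; split; last by rewrite -e.
by split=> [a p q|g gg p]; rewrite -!e //; apply: k.
Qed.

Lemma nb_monomialE M s : nb_monomial R M s = \prod_(F <- expand s) hv R M F.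
Proof.
rewrite /nb_monomial; elim: s => [|p s IH]; first by rewrite !big_nil.
rewrite big_cons IH /= big_cat /=; congr (_ * _).
by elim: p.2 => [|k IHk]; rewrite ?big_nil //= big_cons -IHk exprS.
Qed.

Lemma degf_ptruncs M d phi l N : loopless M -> rk M setT = d.+1 ->
  set0 \notin l -> loopless N -> rk N =1 ptruncs l (rk M) -> degf M d phi ->
  degf N (d - size l) (fun p => phi (p * \prod_(F <- l) hv R M F)).
Proof.
move=> lM rT l0 lN eN dphi; elim: l N l0 lN eN => [|F l IH] N l0 lN eN.
  rewrite subn0; have fN := eq_rk_flat eN.
  have eqnp : npflat N =1 npflat M by move=> G; rewrite /npflat fN.
  apply: (@degf_ext _ _ phi); first by move=> p; rewrite big_nil mulr1.
  case: dphi => -[lphi kphi] v; split; last first.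
    rewrite -v /alpha; congr (phi (_ ^+ _)); apply: eq_bigl => G.
    by rewrite eqnp.
  split=> // g [[G [nG ->]]|[[S [fS [nS ->]]]|[m [m0 ->]]]]; apply: kphi.
  - by left; exists G; rewrite -eqnp.
  - right; left; exists S; split=> //; apply/forall_inP => G GS; rewrite -eqnp.
    by move/forall_inP: fS; apply.
  by right; right; exists m; split=> //; apply: eq_bigl.
move: l0; rewrite inE negb_or eq_sym => /andP[F0 l0].
have [|N' [lN' eN']] := ptruncs_matroid lM l0.
  by move=> x; apply: leq_trans (ptrunc_le F _ _); rewrite -[ptrunc _ _ _]eN lN.
have eNN' : rk N =1 ptrunc F (rk N') by move=> A; rewrite eN /= /ptrunc !eN'.
have rN' : rk N' setT = (d.+1 - size l)%N by rewrite eN' ptruncsT rT.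
have /set0Pn[i iF] := F0.
(* Looplessness of [N] forces this: after truncation a point of [F] has rank at most
   [(rk N' F).-1]. *)
have rF : (1 < rk N' F)%N.
  have := lN i; rewrite eNN' /ptrunc (setUidPr _) ?sub1set //; lia.
have sl : (size l < d)%N.
  have := rk_mono N' (subsetT F); rewrite rN'; lia.
have qN' := ptruncs_quotient lM l0 lN' eN'.
have e : (d - size l = (d - size (F :: l)).+1)%N by rewrite /= subnSK.
have rN2 : rk N' setT = (d - size (F :: l)).+2 by rewrite rN' subSn ?e // ltnW.
have := IH N' l0 lN' eN'; rewrite e.
move=> /(degf_ptrunc lN' lN qN' rN2 eNN' rF); apply: degf_ext => p.
by rewrite big_cons mulrA.
Qed.

(** If some member of the cone is not a flat of [N], its variable is killed, matching the value 0 of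
    the Bergman class. *)
Lemma degf_bergman N M d phi S : loopless N -> quotient N M ->
  rk N setT = d.+1 -> degf N d phi -> cone M d S -> phi (xmono R S) = bergman R N S.
Proof.
move=> lN qN rT dphi /and3P[cS fS /eqP dS].
have [fNS|] := boolP [forall F in S, npflat N F].
  have cS' : cone N d S by rewrite /cone cS fNS dS eqxx.
  by rewrite (cone_val lN rT dphi) // (bergman_cone _ rT).
rewrite negb_forall => /existsP[F]; rewrite negb_imply => /andP[FS nF].
rewrite /bergman cS /= ifF; last first.
  by apply/negP => /andP[/forall_inP/(_ _ FS)]; rewrite (negPf nF).
by rewrite (xmonoD1 _ FS) mulrC; apply: (kills_xv dphi.1 nF).
Qed.

Lemma capw_nested M c d s N phi S : loopless M -> rk M setT = d.+1 -> (c <= d)%N ->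
  nested M c s -> loopless N -> rk N =1 ptruncs (expand s) (rk M) ->
  degfun M d phi -> cone M (d - c) S ->
  capw phi (nb_monomial R M s) S = bergman R N S.
Proof.
move=> lM rT cd [fs ps sc] lN eN dphi cS.
have l0 := set0_expand ps; have qN := ptruncs_quotient lM l0 lN eN.
have := degf_ptruncs lM rT l0 lN eN (degfun_degf lM rT dphi).
rewrite size_expand sc => dN.
have rN : rk N setT = (d - c).+1 by rewrite eN ptruncsT size_expand sc rT subSn.
by rewrite -(degf_bergman lN qN rN dN cS) /capw nb_monomialE mulrC.
Qed.

(** Every nonempty proper flat lies on a maximal flag, where the weight is 1, so the weight
    determines the flats. *)
Lemma bergman_npflat N M d : loopless N -> quotient N M -> rk N setT = d.+1 ->
  forall N', (forall S, cone M d S -> bergman R N S = bergman R N' S) ->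
  forall F, npflat N F -> npflat N' F.
Proof.
move=> lN qN rN N' eqb F fF; have [S [cS FS]] := flag_through lN fF.
rewrite rN /= in cS; have cMS : cone M d S.
  case/and3P: cS => cS /forall_inP fS dS; apply/and3P; split=> //.
  by apply/forall_inP => G /fS; apply: quotient_npflat.
have := eqb S cMS; rewrite (bergman_cone _ rN cS) /bergman.
case: ifP => [/and3P[_ /forall_inP fS _] _|_ /eqP]; first exact: fS.
by rewrite oner_eq0.
Qed.

(** Equal flats give equal ranks, hence the same f-cyclic flats, which form the support, and the
    same nullities, which are the partial sums of the exponents. *)
Lemma nested_inj M c s s' N N' : loopless M -> loopless N -> loopless N' ->
  nested M c s -> nested M c s' ->
  rk N =1 ptruncs (expand s) (rk M) -> rk N' =1 ptruncs (expand s') (rk M) ->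
  npflat N =1 npflat N' -> s = s'.
Proof.
move=> lM lN lN' [fs ps _] [fs' ps' _] eN eN' eqnp.
have eqf : flat N =1 flat N'.
  move=> F; have [->|F0] := eqVneq F set0; first by rewrite !flat0.
  have [->|FT] := eqVneq F setT; first by rewrite !flatT.
  by have := eqnp F; rewrite /npflat F0 FT !andbT.
have eqr := rk_eq_flats eqf.
have fc A B F : flat A =1 flat B -> rk A =1 rk B -> fcyclic A M F -> fcyclic B M F.
  move=> ef er [fF minF]; split; first by rewrite -ef.
  by move=> G; rewrite -ef /nullity -!er => fG pG; apply: minF.
have eqc F : fcyclic N M F <-> fcyclic N' M F.
  by split; apply: fc => // ?; rewrite ?eqf ?eqr.
have eqs F : (F \in set0 :: supp s) = (F \in set0 :: supp s').
  apply/idP/idP.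
    by move/(nested_fcyclic lM fs ps lN eN)/eqc/(nested_fcyclic lM fs' ps' lN' eN').
  by move/(nested_fcyclic lM fs' ps' lN' eN')/eqc/(nested_fcyclic lM fs ps lN eN).
apply: (nested_eq ps ps') => F.
  have [->|F0] := eqVneq F set0.
    by apply/idP/idP => [/(nested_path_mem ps)|/(nested_path_mem ps')]; rewrite properxx.
  by have := eqs F; rewrite !inE (negPf F0).
move=> Fs; have Fs0 : F \in set0 :: supp s by rewrite inE Fs orbT.
have fF := nested_flatN lM fs ps eN Fs0.
have [+ _] := nested_flat_nullity fs ps lN eN fF.
have [+ _] := nested_flat_nullity fs' ps' lN' eN' (etrans (esym (eqf F)) fF).
by rewrite -eqr => -> /addnI.
Qed.

End Evaluation.

(** * Existence of the degree functional *)

Section PtruncsPerm.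
Variable T : finType.
Implicit Types (r : {set T} -> nat) (A B F G : {set T}) (l : seq {set T}).

Lemma eq_ptrunc F r r' : r =1 r' -> ptrunc F r =1 ptrunc F r'.
Proof. by move=> e A; rewrite /ptrunc !e. Qed.

Lemma ptruncC F G r : ptrunc F (ptrunc G r) =1 ptrunc G (ptrunc F r).
Proof. by move=> A; rewrite /ptrunc setUAC; lia. Qed.

Lemma ptruncsC l F r : ptrunc F (ptruncs l r) =1 ptruncs l (ptrunc F r).
Proof.
elim: l => //= G l IH A; rewrite ptruncC; exact: eq_ptrunc.
Qed.

Lemma ptruncs_catC l l' r : ptruncs l (ptruncs l' r) =1 ptruncs l' (ptruncs l r).
Proof.
elim: l => //= F l IH A; rewrite -ptruncsC; exact: eq_ptrunc.
Qed.

Lemma ptruncs_cat l l' r : ptruncs (l ++ l') r = ptruncs l (ptruncs l' r).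
Proof. exact: foldr_cat. Qed.

Lemma perm_ptruncs l l' r : perm_eq l l' -> ptruncs l r =1 ptruncs l' r.
Proof.
move=> pl; suff h A : {homo (fun l => ptruncs l r A) : s t / perm_eq s t >-> s = t}.
  by move=> A; apply: h.
apply: catCA_perm_subst => s1 s2 s3.
by rewrite !ptruncs_cat ptruncs_catC.
Qed.

Lemma ptruncs_le l r A : (ptruncs l r A <= r A)%N.
Proof. by elim: l => //= F l; apply: leq_trans; apply: ptrunc_le. Qed.

Lemma ptruncs_same l r A A' : (forall B, r (B :|: A) = r (B :|: A')) ->
  forall B, ptruncs l r (B :|: A) = ptruncs l r (B :|: A').
Proof.
by move=> e; elim: l => //= F l IH B; rewrite /ptrunc IH (setUAC B A) IH (setUAC B F).
Qed.

End PtruncsPerm.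

(** Moebius inversion from the top down: [z] is fixed on sets by increasing size of the complement.
    It serves to express the [x_F] through the [h_G]. *)
Lemma upper_sum_inversion (T : finType) (V : zmodType) (Q : pred {set T})
  (w : {set T} -> V) : exists z : {set T} -> V,
  forall F, Q F -> \sum_(G | Q G && (F \subset G)) z G = w F.
Proof.
suff [z zP] : exists z : {set T} -> V, forall F : {set T}, (#|~: F| < #|T|.+1)%N ->
    Q F -> \sum_(G | Q G && (F \subset G)) z G = w F.
  by exists z => F; apply: zP; rewrite ltnS max_card.
elim: (#|T|.+1) => [|k [z zP]]; first by exists (fun=> 0).
pose z' (F : {set T}) := if #|~: F| == k
  then w F - \sum_(G | Q G && (F \proper G)) z G else z F.
exists z' => F.
have ltC (G : {set T}) : F \proper G -> (#|~: G| < #|~: F|)%N.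
  by move=> pFG; apply: proper_card; rewrite properC.
rewrite ltnS => leF QF.
have split u : \sum_(G | Q G && (F \subset G)) u G =
    u F + \sum_(G | Q G && (F \proper G)) u G :> V.
  rewrite (bigD1 F) /= ?QF ?subxx //; congr (_ + _); apply: eq_bigl => G.
  by rewrite properEneq (eq_sym F) -andbA (andbC (G != F)).
have -> : \sum_(G | Q G && (F \subset G)) z' G =
    z' F + \sum_(G | Q G && (F \proper G)) z G.
  rewrite split; congr (_ + _); apply: eq_bigr => G /andP[_ /ltC ltG].
  by rewrite /z' ltn_eqF // (leq_trans ltG).
rewrite /z'; case: eqP => [_|/eqP neq]; first by rewrite subrK.
by rewrite -(zP F) ?split // ltn_neqAle neq.
Qed.

Section Existence.
Variables (R : comNzRingType) (n : nat).
Local Notation E := ('I_n.+1).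
Local Notation P := (cpoly R n).
Implicit Types (F G A B : {set E}) (S : {set {set E}}) (p q : P).
Implicit Types (m : 'X_{1..nvar n}) (l : seq {set E}).

Definition msets m : seq {set E} :=
  flatten [seq nseq (m i) (enum_val i) | i <- enum 'I_(nvar n)].

Lemma count_msets m F : count_mem F (msets m) = m (enum_rank F).
Proof.
rewrite count_flatten -map_comp sumnE big_map big_enum /=.
rewrite (bigD1 (enum_rank F)) //= count_nseq /= enum_rankK eqxx mul1n.
rewrite big1 ?addn0 // => i ne; rewrite count_nseq /= [_ == F]negbTE //.
by apply: contra ne => /eqP<-; rewrite enum_valK.
Qed.

Lemma perm_msets m F : perm_eq (msets (U_(enum_rank F) + m)%MM) (F :: msets m).
Proof.
apply/allP => G _ /=; rewrite !count_msets mnmDE mnm1E.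
by rewrite (inj_eq enum_rank_inj).
Qed.

Lemma size_msets m : size (msets m) = mdeg m.
Proof.
rewrite size_flatten /shape -map_comp sumnE big_map big_enum /= mdegE.
by apply: eq_bigr => i _; rewrite size_nseq.
Qed.

Variables (d : nat) (M : matroid E).
Hypotheses (lM : loopless M) (rT : rk M setT = d.+1).

(* The dragon Hall-Rado condition on the list [l], phrased through iterated
   principal truncations. *)
Definition dhr l := (set0 \notin l) && [forall x, (0 < ptruncs l (rk M) [set x])%N].

Lemma perm_dhr l l' : perm_eq l l' -> dhr l = dhr l'.
Proof.
move=> pl; rewrite /dhr (perm_mem pl); congr (_ && _).
by apply: eq_forallb => x; rewrite (perm_ptruncs _ pl).
Qed.

Lemma ptruncs_cl F l : ptruncs (cl M F :: l) (rk M) =1 ptruncs (F :: l) (rk M).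
Proof.
move=> A /=; rewrite /ptrunc; congr (minn _ _.-1); apply: ptruncs_same => B.
by rewrite setUC rk_clU setUC.
Qed.

Lemma dhr_cl F l : F != set0 -> dhr (cl M F :: l) = dhr (F :: l).
Proof.
move=> F0; rewrite /dhr !inE !negb_or ![set0 == _]eq_sym F0.
have -> : cl M F != set0.
  by apply: contra F0 => /eqP e; rewrite -subset0 -e sub_cl.
by congr (_ && _); apply: eq_forallb => x; rewrite ptruncs_cl.
Qed.

Lemma dhr_swap F G l : dhr (F :: G :: l) = dhr (G :: F :: l).
Proof. by apply: perm_dhr; apply/permPl; exact: (perm_catCA [:: F] [:: G] l). Qed.

Lemma dhr2 N F G l : rk N =1 ptruncs l (rk M) -> loopless N -> set0 \notin l ->
  F != set0 -> G != set0 ->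
  dhr (F :: G :: l) = [&& 1 < rk N F, 1 < rk N G & 2 < rk N (F :|: G)]%N.
Proof.
move=> eN lN l0 F0 G0; rewrite /dhr !inE !negb_or ![set0 == _]eq_sym F0 G0 l0 /=.
have pE x : ptrunc F (ptrunc G (ptruncs l (rk M))) [set x] =
    minn (minn (rk N [set x]) (rk N (x |: G)).-1)
         (minn (rk N (x |: F)) (rk N (x |: (F :|: G))).-1).-1.
  by rewrite /ptrunc -!eN setUA.
apply/forallP/and3P => [h|[rF rG rFG] x].
  have /set0Pn[x xF] := F0; have /set0Pn[y yG] := G0.
  have := h x; have := h y; rewrite !pE.
  rewrite [y |: G](setUidPr _) ?sub1set // [x |: F](setUidPr _) ?sub1set //.
  by rewrite [x |: (F :|: G)](setUidPr _) ?sub1set ?inE ?xF //; split; lia.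
rewrite pE lN; have := rk_mono N (subsetUr [set x] F).
have := rk_mono N (subsetUr [set x] G).
by have := rk_mono N (subsetUr [set x] (F :|: G)); lia.
Qed.

(** By [dhr2] the difference of the two sides is the product of the indicators of [rk N F <= 1],
    [rk N G <= 1] and [2 < rk N (F :|: G)], which cannot all hold by submodularity. *)
Lemma dhr_quad F G l : F != set0 -> G != set0 -> (size l).+2 = d ->
  (dhr (F :: G :: l) + dhr (F :|: G :: F :|: G :: l) =
   dhr (F :: F :|: G :: l) + dhr (G :: F :|: G :: l))%N.
Proof.
move=> F0 G0 sl; have K0 : F :|: G != set0 by rewrite setU_eq0 negb_and F0.
have [l0|l0] := boolP (set0 \in l).
  by rewrite /dhr !inE l0 !orbT.
(* A loop already created by [l] makes all four terms zero. *)
have [/forallP pos|npos] := boolP [forall x, 0 < ptruncs l (rk M) [set x]]%N; last first.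
  have f A B : dhr (A :: B :: l) = false.
    apply/negP => /andP[_ /forallP h]; case/negP: npos; apply/forallP => x.
    by apply: leq_trans (h x) (ptruncs_le [:: A; B] _ _).
  by rewrite !f.
have [N [lN eN]] := ptruncs_matroid lM l0 pos.
rewrite !(dhr2 eN lN l0) // setUid setUA setUid [G :|: (F :|: G)]setUCA setUid.
have := rk_submod N F G; lia.
Qed.

(** Here the variable [xv R F] stands for [h_F], not for [x_F]. The bounded index type contains
    every monomial of degree at most [d], whatever [p] is. *)
Definition dhrf p : R :=
  \sum_(m : bmultinom (nvar n) d.+1) p@_m * ((mdeg m == d) && dhr (msets m))%:R.

Lemma dhrf_lin : lin dhrf.
Proof.
move=> a p q; rewrite /dhrf mulr_sumr -big_split; apply: eq_bigr => m _ /=.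
by rewrite mcoeffD mcoeffZ mulrDl mulrA.
Qed.

Lemma dhrfX m : dhrf 'X_[m] = ((mdeg m == d) && dhr (msets m))%:R.
Proof.
rewrite /dhrf; have [md|md] := boolP (mdeg m < d.+1)%N.
  rewrite (bigD1 (BMultinom md)) //= mcoeffX eqxx mul1r big1 ?addr0 // => k nk.
  rewrite mcoeffX [m == _]negbTE ?mul0r //.
  by apply: contra nk => /eqP e; apply/eqP/val_inj.
rewrite big1 => [|k _].
  by rewrite [mdeg m == d]negbTE //; apply: contra md => /eqP->.
rewrite mcoeffX [m == _]negbTE ?mul0r //.
by apply: contra md => /eqP->; apply: bmdeg.
Qed.

Lemma kills_monomials phi q : lin phi -> (forall m, phi ('X_[m] * q) = 0) -> kills phi q.
Proof.
move=> lphi h p; rewrite [p]mpolyE mulr_suml (lin_sum lphi) big1 // => m _.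
by rewrite -scalerAl (linZ lphi) h mulr0.
Qed.

Lemma dhrfX2 m F G : dhrf ('X_[m] * (xv R F * xv R G)) =
  (((mdeg m).+2 == d) && dhr (F :: G :: msets m))%:R.
Proof.
rewrite /xv mulrC -mulrA -!mpolyXD dhrfX !mdegD !mdeg1 !add1n.
congr ((_ && _)%:R); apply: perm_dhr; apply: perm_trans (perm_msets _ _) _.
by rewrite perm_cons perm_msets.
Qed.

(** This is [dhr_quad] multiplied by a monomial; replacing [K] by its closure changes no
    truncation. *)
Lemma kills_quad F G : F != set0 -> G != set0 -> let K := F :|: G in
  kills dhrf ((xv R (cl M K) - xv R F) * (xv R (cl M K) - xv R G)).
Proof.
move=> F0 G0 K; apply: (kills_monomials dhrf_lin) => m.
have K0 : K != set0 by rewrite setU_eq0 negb_and F0.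
rewrite mulrBl !mulrBr !(linB dhrf_lin) !dhrfX2.
case: eqP => [md|_]; last by rewrite !subrr.
rewrite !dhr_cl // [dhr (_ :: cl M K :: _)]dhr_swap dhr_cl //.
rewrite [dhr (F :: cl M K :: _)]dhr_swap dhr_cl //.
have := dhr_quad F0 G0 (_ : (size (msets m)).+2 = d).
rewrite size_msets md -/K => /(_ erefl).
rewrite [dhr (K :: G :: _)]dhr_swap [dhr (K :: F :: _)]dhr_swap.
by case: (dhr _); case: (dhr _); case: (dhr _); case: (dhr _) => //= _; ring.
Qed.

(** * Change of variables from the [x_F] to the [h_F] *)

Section Theta.
Variable z : {set E} -> P.
(** As [xv R setT] stands for [h_E], which is [alpha], this is the definition of [h_F] read as a
    system of equations for the images [z G] of the [x_G]. *)
Hypothesis zP : forall F, npflat M F ->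
  \sum_(G | npflat M G && (F \subset G)) z G = xv R setT - xv R F.

Lemma theta_sum A : A != set0 ->
  \sum_(G | npflat M G && (A \subset G)) z G = xv R setT - xv R (cl M A).
Proof.
move=> A0; rewrite (eq_bigl (fun G => npflat M G && (cl M A \subset G))); last first.
  move=> G; have [/and3P[fG _ _]|//] := boolP (npflat M G).
  apply/idP/idP => [|/(subset_trans (sub_cl _ _))//]; exact: cl_min.
have [->|AT] := eqVneq (cl M A) setT; last first.
  apply: zP; rewrite /npflat flat_cl AT andbT /=.
  by apply: contra A0 => /eqP e; rewrite -subset0 -e sub_cl.
rewrite subrr big1 // => G /andP[/and3P[_ _ GT]].
by rewrite subTset (negPf GT).
Qed.

(** The product in [kills_quad] expands over pairs [A], [B] of flats above [F] and [G], neither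
    containing the union [K]. Such pairs stay incomparable, since [A \subset B] would put [K] inside
    [B]. All pairs but [(F, G)] have smaller complements, so induction isolates [z F * z G]. *)
Lemma kills_theta2 F G : npflat M F -> npflat M G ->
  ~~ (F \subset G) -> ~~ (G \subset F) -> kills dhrf (z F * z G).
Proof.
move: {2}(_ + _)%N (leqnn (#|~: F| + #|~: G|)%N) => k.
elim: k F G => [|k IH] F G lek fF fG FG GF.
  have /and3P[_ _ /negP[]] := fF; move: lek; rewrite leqn0 addn_eq0 cards_eq0.
  by case/andP=> /eqP e _; rewrite -(setCK F) e setC0.
have /and3P[_ F0 _] := fF; have /and3P[_ G0 _] := fG.
pose K := F :|: G; have K0 : K != set0 by rewrite setU_eq0 negb_and F0.
have sub A : A \subset K ->
    \sum_(H | npflat M H && ((A \subset H) && ~~ (K \subset H))) z H =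
    (\sum_(H | npflat M H && (A \subset H)) z H)
    - \sum_(H | npflat M H && (K \subset H)) z H.
  move=> sAK; rewrite (bigID (fun H : {set E} => K \subset H) (fun H => npflat M H && (A \subset H))) /=.
  have -> : \sum_(H | npflat M H && (A \subset H) && (K \subset H)) z H =
      \sum_(H | npflat M H && (K \subset H)) z H.
    apply: eq_bigl => H; rewrite -andbA; congr (_ && _).
    by apply/andP/idP => [[]//|sKH]; split=> //; apply: subset_trans sKH.
  rewrite [RHS]addrC addKr; apply: eq_bigl => H; exact: andbA.
have ww A : npflat M A -> A \subset K ->
    \sum_(H | npflat M H && ((A \subset H) && ~~ (K \subset H))) z H =
    xv R (cl M K) - xv R A.
  by move=> fA sAK; rewrite sub // zP // theta_sum //; ring.
have : kills dhrf ((xv R (cl M K) - xv R F) * (xv R (cl M K) - xv R G)) := kills_quad F0 G0.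
rewrite -(ww F) ?subsetUl // -(ww G) ?subsetUr //.
rewrite big_distrlr pair_big /= (bigD1 (F, G)) /=; last first.
  by rewrite fF fG !subxx /= /K !subUset !subxx /= andbT GF FG.
move=> kall; rewrite -[z F * z G](addrK (\sum_(H | [&& [&& npflat M H.1, F \subset H.1 & ~~ (K \subset H.1)],
   npflat M H.2, G \subset H.2 & ~~ (K \subset H.2)] && (H != (F, G))) z H.1 * z H.2)).
apply: (killsB dhrf_lin) => //; apply: (kills_sum dhrf_lin) => -[A B] /=.
case/andP=> /andP[/and3P[fA sFA nKA] /and3P[fB sGB nKB]] neq.
rewrite subUset sFA /= in nKA; rewrite subUset sGB andbT in nKB.
apply: IH => //; last first.
- by apply: contra nKA; apply: subset_trans.
- by apply: contra nKB; apply: subset_trans.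
have cA : (#|~: A| <= #|~: F| ?= iff (~: A == ~: F))%N.
  by apply: subset_leqif_cards; rewrite setCS.
have cB : (#|~: B| <= #|~: G| ?= iff (~: B == ~: G))%N.
  by apply: subset_leqif_cards; rewrite setCS.
rewrite -ltnS; apply: leq_trans lek; rewrite ltn_neqAle.
have := leqif_add cA cB; case=> -> ->; rewrite andbT.
by apply: contra neq => /andP[/eqP/setC_inj-> /eqP/setC_inj->].
Qed.

Definition theta p : P :=
  p \mPo [tuple if npflat M (enum_val i) then z (enum_val i) else 0 | i < nvar n].

Lemma theta_xv F : theta (xv R F) = if npflat M F then z F else 0.
Proof. by rewrite /theta comp_mpolyXU -tnth_nth tnth_mktuple enum_rankK. Qed.

Lemma thetaM p q : theta (p * q) = theta p * theta q.
Proof. exact: rmorphM. Qed.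

Lemma theta_sumxv (Q : pred {set E}) (c : {set E} -> R) :
  theta (\sum_(G | npflat M G && Q G) c G *: xv R G)
  = \sum_(G | npflat M G && Q G) c G *: z G.
Proof.
rewrite /theta raddf_sum; apply: eq_bigr => G /andP[fG _] /=.
by rewrite comp_mpolyZ -/(theta _) theta_xv fG.
Qed.

(** Truncating along the closure of a point makes that point a loop; this is the vanishing of [h_F]
    in rank one. *)
Lemma kills_loop i : kills dhrf (xv R (cl M [set i])).
Proof.
apply: (kills_monomials dhrf_lin) => m.
rewrite /xv mulrC -mpolyXD dhrfX (perm_dhr (perm_msets _ _)) dhr_cl; last first.
  by apply/set0Pn; exists i; rewrite inE.
rewrite [dhr _]negbTE ?andbF //; apply/negP => /andP[_ /forallP/(_ i)] /=.
rewrite /ptrunc setUid; have := ptruncs_le (msets m) (rk M) [set i].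
by rewrite lM; lia.
Qed.

Lemma theta_chowfun : chowfun M (dhrf \o theta).
Proof.
split=> [a p q|g].
  by rewrite /= /theta comp_mpolyD comp_mpolyZ dhrf_lin.
suff k : chow_gen M g -> kills dhrf (theta g).
  by move=> /k kg p; rewrite /= thetaM kg.
case=> [[F [nF ->]]|[[S [fS [nS ->]]]|[c [c0 ->]]]].
- by rewrite theta_xv (negPf nF); apply: (kills0 dhrf_lin).
- move: nS; rewrite negb_forall => /existsP[F]; rewrite negb_imply.
  case/andP=> FS; rewrite negb_forall => /existsP[G]; rewrite negb_imply.
  case/andP=> GS; rewrite negb_or => /andP[FG GF].
  have neq : G \in S :\ F by rewrite !inE GS andbT; apply: contraNneq FG => ->.
  rewrite (xmonoD1 _ FS) (xmonoD1 _ neq) mulrA thetaM; apply: killsMr.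
  move/forall_inP: fS => fS.
  by rewrite thetaM !theta_xv !fS //; apply: kills_theta2; rewrite ?fS.
have := theta_sumxv predT (fun F => (\sum_(i in F) c i)%:~R).
rewrite !(eq_bigl _ _ (fun=> andbT _)) => ->.
(* Grouped by elements [i], the inner sum is [h_E] minus the [h] of the closure of [i]. The first
   part vanishes because the weights sum to zero, the second by [kills_loop]. *)
have -> : \sum_(F | npflat M F) (\sum_(i in F) c i)%:~R *: z F =
    \sum_i (c i)%:~R *: \sum_(F | npflat M F && ([set i] \subset F)) z F.
  under [RHS]eq_bigr do rewrite scaler_sumr big_mkcondr /=.
  rewrite exchange_big; apply: eq_bigr => F _ /=.
  rewrite rmorph_sum scaler_suml big_mkcond; apply: eq_bigr => i _.
  by rewrite sub1set.
rewrite (eq_bigr (fun i => (c i)%:~R *: xv R setT - (c i)%:~R *: xv R (cl M [set i])));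
  last first.
  move=> i _; rewrite theta_sum ?scalerBr //.
  by apply/set0Pn; exists i; rewrite inE.
rewrite sumrB -scaler_suml -rmorph_sum c0 scale0r; apply: (killsB dhrf_lin).
  exact: (kills0 dhrf_lin).
by apply: (kills_sum dhrf_lin) => i _; apply: (killsZ dhrf_lin); apply: kills_loop.
Qed.

Lemma dhrfT : dhrf (xv R setT ^+ d) = 1.
Proof.
rewrite /xv mpolyXn dhrfX mdegMn mdeg1 mul1n eqxx /=.
have pm k : perm_eq (msets (U_(enum_rank [set: E]) *+ k)%MM) (nseq k setT).
  elim: k => [|k IH].
    by apply/allP => F _ /=; rewrite count_msets mulm0n mnm0E.
  by rewrite mulmS (perm_trans (perm_msets _ _)) //= perm_cons.
rewrite (perm_dhr (pm d)) /dhr.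
have T0 : [set: E] != set0 by apply/set0Pn; exists ord0.
rewrite mem_nseq eq_sym (negPf T0) andbF /=.
suff -> : [forall x, 0 < ptruncs (nseq d [set: E]) (rk M) [set x]]%N by [].
apply/forallP => x.
(* The minimum runs over [set0] and [setT] only, with values [rk M [set x]] and [d.+1 - d], both
   equal to 1. *)
have [||F [FQ]] := @ptruncs_attained _ (nseq d setT) (rk M) [set x]
  (fun F => F \in [:: set0; setT]); first by rewrite inE eqxx.
  by move=> F G _; rewrite mem_nseq => /andP[_ /eqP->]; rewrite setTU !inE eqxx orbT.
apply: leq_trans; move: FQ; rewrite count_nseq !inE => /orP[]/eqP->.
  by rewrite subTset eq_sym (negPf T0) setU0 lM.
by rewrite setUT rT subxx mul1n subSnn.
Qed.

Lemma theta_degf : degf M d (dhrf \o theta).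
Proof.
split=> /=; first exact: theta_chowfun.
have -> : theta (alpha R M ^+ d) = theta (alpha R M) ^+ d by apply: rmorphXn.
(* Up to a killed term [alpha] becomes the variable standing for [h_E], whose power is evaluated by
   [dhrfT]. *)
have e : theta (alpha R M) = xv R setT - xv R (cl M [set ord0]).
  rewrite -theta_sum; last by apply/set0Pn; exists ord0; rewrite inE.
  have := theta_sumxv (fun G => ord0 \in G) (fun=> 1).
  under eq_bigr do rewrite scale1r; under [RHS]eq_bigr do rewrite scale1r.
  move=> ->; by apply: eq_bigl => G; rewrite sub1set.
have k : kills dhrf (theta (alpha R M) - xv R setT).
  rewrite e [_ - _ - _]addrAC subrr sub0r => p; rewrite mulrN (linN dhrf_lin).
  by rewrite kills_loop oppr0.
by have := kills_eq dhrf_lin 1 (killsBX d k); rewrite !mul1r /= => ->; apply: dhrfT.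
Qed.

End Theta.

Lemma degf_exists : exists phi : P -> R, degf M d phi.
Proof.
have [z zP] := upper_sum_inversion (npflat M) (fun F => xv R setT - xv R F).
by exists (dhrf \o theta z); apply: theta_degf.
Qed.

End Existence.

(** * The correspondence between nested monomials and Bergman classes *)

Theorem theorem3p24 (R : realFieldType) (n d : nat) (M : matroid 'I_n.+1)
  (hM : loopless M) (hrk : rk M setT = d.+1) (c : nat) (hc : (c <= d)%N) :
  (exists phi : cpoly R n -> R, degfun M d phi) /\
  forall phi : cpoly R n -> R, degfun M d phi ->
  [/\
    (* every nested monomial is sent to a Bergman class of a relative nested quotient *)
    forall s, nested M c s ->
      exists M' : matroid 'I_n.+1,
        [/\ loopless M', quotient M' M, rel_nested M' M,
            rk M' setT = (d.+1 - c)%N &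
            forall S, cone M (d - c) S ->
              capw phi (nb_monomial R M s) S = bergman R M' S],
    (* injectivity on the nested basis *)
    forall s s', nested M c s -> nested M c s' ->
      (forall S, cone M (d - c) S ->
         capw phi (nb_monomial R M s) S = capw phi (nb_monomial R M s') S) ->
      s = s' &
    (* surjectivity onto Bergman classes *)
    forall M' : matroid 'I_n.+1,
      loopless M' -> quotient M' M -> rel_nested M' M ->
      rk M' setT = (d.+1 - c)%N ->
      exists s, nested M c s /\
        forall S, cone M (d - c) S ->
          capw phi (nb_monomial R M s) S = bergman R M' S].
Proof.
split.
  have [phi /(degf_degfun hM hrk) dphi] := degf_exists R hM hrk.
  by exists phi.
have rN s N : nested M c s -> rk N =1 ptruncs (expand s) (rk M) ->
    rk N setT = (d - c).+1.
  by case=> _ _ sc eN; rewrite eN ptruncsT size_expand sc hrk subSn.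
move=> phi dphi; split.
- move=> s ns; have [fs ps sc] := ns.
  have [N [lN eN]] := nested_matroid hM ps; exists N; split=> //.
  + exact (nested_quotient hM ps lN eN).
  + exact (nested_rel_nested hM fs ps lN eN).
  + by rewrite (rN s) // subSn.
  by move=> S; apply: capw_nested hM hrk hc ns lN eN dphi.
- move=> s s' ns ns' eqw; have [fs ps _] := ns; have [fs' ps' _] := ns'.
  have [N [lN eN]] := nested_matroid hM ps.
  have [N' [lN' eN']] := nested_matroid hM ps'.
  (* Equality of the caps becomes equality of two Bergman classes on the cones of [M], from which
     the flats of both truncations are read off. *)
  have eqb S : cone M (d - c) S -> bergman R N S = bergman R N' S.
    move=> cS; rewrite -(capw_nested hM hrk hc ns lN eN dphi cS).
    by rewrite eqw // (capw_nested hM hrk hc ns' lN' eN' dphi cS).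
  apply: (nested_inj hM lN lN' ns ns' eN eN') => F; apply/idP/idP.
    exact: (bergman_npflat (R := R) lN (nested_quotient hM ps lN eN) (rN s N ns eN) eqb).
  apply: (bergman_npflat (R := R) lN' (nested_quotient hM ps' lN' eN') (rN s' N' ns' eN')).
  by move=> S cS; rewrite eqb.
move=> M' lM' qM' rM' rkM'.
(* The rank of [M'] itself is the iterated truncation along [s], so the evaluation of nested
   monomials applies directly to [M']. *)
have [||s [ns eM']] := nested_of_quotient (c := c) lM' qM' rM'.
- by rewrite rkM' hrk.
- by rewrite hrk ltnW.
by exists s; split=> // S; apply: capw_nested hM hrk hc ns lM' eM' dphi.
Qed.
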